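(* Let $d\in\mathbb{N}$ and $q\in(-1,1)$, and consider the selfadjoint operator $$X_{d;q}:=\Bigl(\sum_{i=1}^d(L_{i;q}+L_{i;q}^* )\otimes(L_{i;q}+L_{i;q}^* )\Bigr)^2\in B(\mathcal{T}_{d;q})\otimes B(\mathcal{T}_{d;q}),$$ where $\mathcal{T}_{d;q}$ is the $q$-Fock space over $\mathbb{C}^d$ and $L_{i;q}$ is the left $q$-creation operator associated to the standard basis vector $e_i$. The moments of $X_{d;q}$ with respect to the state $\varphi_{\mathrm{vac}}\otimes\varphi_{\mathrm{vac}}$ on $B(\mathcal{T}_{d;q})\otimes B(\mathcal{T}_{d;q})$ are $$(\varphi_{\mathrm{vac}}\otimes\varphi_{\mathrm{vac}})(X_{d;q}^n)=\widetilde{P}_n(d,q),\qquad\forall\,n\in\mathbb{N}.$$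
   Context: $\mathbb{N}=\{1,2,3,\dots\}$; inner products are linear in the first variable; $0^0=1$. $q$-Fock space. For $n\in\mathbb{N}$, equip $(\mathbb{C}^d)^{\otimes n}$ with the inner product determined by $\langle v_1\otimes\cdots\otimes v_n, w_1\otimes\cdots\otimes w_n\rangle_q=\sum_{\tau\in S_n} q^{\iota(\tau)}\prod_{i=1}^n\langle v_i,w_{\tau(i)}\rangle$, where $\iota(\tau)=|\{(i,j): 1\le i<j\le n,\ \tau(i)>\tau(j)\}|$ (this is known to be an inner product). $\mathcal{T}_{d;q}$ is the Hilbert space orthogonal direct sum $\mathbb{C}\oplus\bigoplus_{n\ge1}(\mathbb{C}^d)^{\otimes n}$; the vector $1\in\mathbb{C}$ is the vacuum vector $\xi_{\mathrm{vac}}$, and $\varphi_{\mathrm{vac}}(X)=\langle X\xi_{\mathrm{vac}},\xi_{\mathrm{vac}}\rangle$ for $X\in B(\mathcal{T}_{d;q})$. $\varphi_{\mathrm{vac}}\otimes\varphi_{\mathrm{vac}}$ is the tensor product state, i.e. the vector state of $\xi_{\mathrm{vac}}\otimes\xi_{\mathrm{vac}}$ when $B(\mathcal{T}_{d;q})\otimes B(\mathcal{T}_{d;q})$ acts on the Hilbert space tensor product $\mathcal{T}_{d;q}\otimes\mathcal{T}_{d;q}$. With $e_1,\dots,e_d$ the standard orthonormal basis of $\mathbb{C}^d$, $L_{i;q}\in B(\mathcal{T}_{d;q})$ is the (bounded) operator determined by $L_{i;q}\xi_{\mathrm{vac}}=e_i$, $L_{i;q}(v_1\otimes\cdots\otimes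 v_n)=e_i\otimes v_1\otimes\cdots\otimes v_n$; $^*$ denotes the adjoint. Polynomials. $\mathcal{P}_2(2n)$ is the set of pair-partitions of $\{1,\dots,2n\}$ (partitions into $n$ blocks of size 2). Two distinct blocks of $\pi\in\mathcal{P}_2(2n)$ cross if, writing their union as $\{a<b<c<d\}$, one block is $\{a,c\}$ and the other $\{b,d\}$; $\mathrm{cr}(\pi)$ is the number of unordered pairs of crossing blocks. $\pi\vee\sigma$ is the join in the lattice of all partitions of $\{1,\dots,2n\}$ under reverse refinement order (the finest partition of which both $\pi,\sigma$ are refinements), and $|\cdot|$ is the number of blocks. A self-intersecting meandric system of order $n$ is a pair $(\pi,\sigma)\in\mathcal{P}_2(2n)^2$ ($\pi$ drawn above and $\sigma$ below a horizontal line); its number of crossings is $\mathrm{cr}(\pi)+\mathrm{cr}(\sigma)$ and its number of closed curves is $|\pi\vee\sigma|$. Let $m_n^{(k,\ell)}$ be the number of such systems having exactly $k$ closed curves and $\ell$ crossings, and $\widetilde{P}_n(t,u)=\sum_{k=1}^n\sum_{\ell=0}^{n^2-n}m_n^{(k,\ell)}t^ku^\ell$. Equivalently, $\widetilde{P}_n(t,u)=\sum_{\pi,\sigma\in\mathcal{P}_2(2n)}t^{|\pi\vee\sigma|}u^{\mathrm{cr}(\pi)+\mathrm{cr}(\sigma)}$. *)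

(* Defs.v *)
From HB Require Import structures.
From mathcomp Require Import all_boot all_order all_algebra all_fingroup.
Set Implicit Arguments.
Unset Strict Implicit.
Unset Printing Implicit Defensive.
Import Order.TTheory GRing.Theory Num.Theory.
Local Open Scope ring_scope.

Section Meanders.
Variable m : nat.
Implicit Types (V W : {set 'I_m}) (P Q J : {set {set 'I_m}}).

Definition crossing V W : bool :=
  [exists a : 'I_m, exists b : 'I_m, exists c : 'I_m, exists e : 'I_m,
    [&& (a < b)%N, (b < c)%N, (c < e)%N &
      (V == [set a; c]) && (W == [set b; e]) ||
      (V == [set b; e]) && (W == [set a; c])]].

Definition crossings P : nat := #|[set [set V; W] | V in P, W in P & crossing V W]|.

(* [refines P Q]: every block of [P] lies in a block of [Q]. *)
Definition refines P Q : bool := [forall V in P, exists W in Q, V \subset W].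

Definition is_join P Q J : bool :=
  [&& partition J [set: 'I_m], refines P J, refines Q J &
    [forall J', [&& partition J' [set: 'I_m], refines P J' & refines Q J'] ==>
      refines J J']].

(* The finest common coarsening; the default value is never used on partitions,
   see [partition_joinP]. *)
Definition partition_join P Q : {set {set 'I_m}} := odflt set0 [pick J | is_join P Q J].

Lemma partition_joinP P Q : partition P [set: 'I_m] -> partition Q [set: 'I_m] ->
  is_join P Q (partition_join P Q).
Proof.
move=> Ppart Qpart; rewrite /partition_join; case: pickP => //= noJ.
pose r := [rel x y : 'I_m | [exists V in P :|: Q, (x \in V) && (y \in V)]].
have rsym : symmetric r.
  by move=> x y; apply: eq_existsb => V; rewrite [(x \in V) && _]andbC.
have csym : connect_sym r by apply: sym_connect_sym.
pose J := equivalence_partition (connect r) [set: 'I_m].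
have Jpart : partition J [set: 'I_m].
  apply: equivalence_partitionP => x y z _ _ _; split; first exact: connect0.
  by move=> xy; apply: same_connect.
have refJ S : partition S [set: 'I_m] -> S \subset P :|: Q -> refines S J.
  move=> Spart /subsetP SPQ; apply/forall_inP => V VS.
  have /set0Pn[x xV] : V != set0.
    by apply: contraTneq VS => ->; case/and3P: Spart.
  apply/exists_inP; exists [set y in [set: 'I_m] | connect r x y].
    by apply/imsetP; exists x.
  apply/subsetP => y yV; rewrite !inE /=; apply: connect1 => /=.
  by apply/exists_inP; exists V; [exact: SPQ | rewrite xV].
suff : is_join P Q J by rewrite noJ.
apply/and4P; split=> //; [exact: refJ (subsetUl _ _) | exact: refJ (subsetUr _ _) |].
apply/forall_inP => J' /and3P[J'part PJ' QJ'].
have tJ' : trivIset J' by case/and3P: J'part.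
have covJ' x : x \in cover J' by have [/eqP -> _ _] := and3P J'part; rewrite inE.
apply/forall_inP => V /imsetP[x _ ->].
apply/exists_inP; exists (pblock J' x); first exact: pblock_mem.
apply/subsetP => y; rewrite !inE /= => xy.
suff cl : closed r (pblock J' x).
  by rewrite -(closed_connect cl xy) mem_pblock.
apply: intro_closed => // a b /exists_inP[W WPQ /andP[aW bW]] ax.
have [W' W'J' /subsetP WW'] : exists2 W', W' \in J' & W \subset W'.
  by move: WPQ; rewrite inE => /orP[WP|WQ]; apply/exists_inP;
    [exact: (forall_inP PJ') | exact: (forall_inP QJ')].
rewrite -(def_pblock tJ' (pblock_mem (covJ' x)) ax).
by rewrite (def_pblock tJ' W'J' (WW' _ aW)); apply: WW'.
Qed.

End Meanders.

Definition pair_partitions (n : nat) : {set {set {set 'I_(2 * n)}}} :=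
  [set P | partition P [set: 'I_(2 * n)] && [forall V in P, #|V| == 2%N]].

Definition meander_count (n k l : nat) : nat :=
  #|[set PQ : {set {set 'I_(2 * n)}} * {set {set 'I_(2 * n)}} |
      [&& PQ.1 \in pair_partitions n, PQ.2 \in pair_partitions n,
          #|partition_join PQ.1 PQ.2| == k & crossings PQ.1 + crossings PQ.2 == l]%N]|.

Definition meander_poly (A : comNzRingType) (n : nat) (t u : A) : A :=
  \sum_(1 <= k < n.+1) \sum_(0 <= l < (n ^ 2 - n).+1)
    (meander_count n k l)%:R * t ^+ k * u ^+ l.

From mathcomp Require Import all_classical all_reals all_analysis.
From mathcomp Require Import complex ring lra.
Import numFieldNormedType.Exports.
Local Open Scope complex_scope.

HB.mixin Record Lmodule_isPreHilbert (R : realType) V of GRing.Lmodule R[i] V := {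
  dot : V -> V -> R[i];
  dotDl : forall x y z, dot (x + y) z = dot x z + dot y z;
  dotZl : forall (a : R[i]) x z, dot (a *: x) z = a * dot x z;
  dotJ : forall x y, dot y x = (dot x y)^*;
  dot_gt0 : forall x, x != 0 -> 0 < dot x x }.

#[short(type="preHilbertType")]
HB.structure Definition PreHilbert (R : realType) :=
  { V of GRing.Lmodule R[i] V & Lmodule_isPreHilbert R V }.

Definition hnorm2 (R : realType) (V : preHilbertType R) (x : V) : R :=
  complex.Re (dot x x).
Definition hnorm (R : realType) (V : preHilbertType R) (x : V) : R :=
  Num.sqrt (hnorm2 x).

HB.mixin Record PreHilbert_isComplete (R : realType) V of PreHilbert R V := {
  hcomplete : forall x : nat -> V,
    (forall e : R, 0 < e -> exists N, forall m n, (N <= m)%N -> (N <= n)%N ->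
       hnorm (x m - x n) < e) ->
    exists l : V, forall e : R, 0 < e -> exists N, forall n, (N <= n)%N ->
      hnorm (x n - l) < e }.

#[short(type="hilbertType")]
HB.structure Definition Hilbert (R : realType) :=
  { V of PreHilbert R V & PreHilbert_isComplete R V }.

Section PreHilbertTheory.
Variables (R : realType) (V : preHilbertType R).
Implicit Types x y z : V.

Lemma dotDr x y z : dot z (x + y) = dot z x + dot z y.
Proof. by rewrite dotJ dotDl rmorphD /= -!dotJ. Qed.

Lemma dotZr (a : R[i]) x z : dot z (a *: x) = a^* * dot z x.
Proof. by rewrite dotJ dotZl rmorphM /= -!dotJ. Qed.

Lemma dot0l z : dot 0 z = 0.
Proof. by rewrite -[in dot _ _](scale0r (0 : V)) dotZl mul0r. Qed.

Lemma dot0r x : dot x 0 = 0.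
Proof. by rewrite dotJ dot0l conjc0. Qed.

Lemma hnorm2C x : (hnorm2 x)%:C = dot x x.
Proof.
have [->|/dot_gt0/gtr0_real/RRe_real//] := eqVneq x 0.
by rewrite /hnorm2 dot0l.
Qed.

Lemma hnorm2_0 : hnorm2 (0 : V) = 0.
Proof. by rewrite /hnorm2 dot0l. Qed.

Lemma hnorm2_gt0 x : x != 0 -> 0 < hnorm2 x.
Proof. by move=> /dot_gt0; rewrite -hnorm2C ltcR. Qed.

Lemma hnorm2_ge0 x : 0 <= hnorm2 x.
Proof.
by have [->|/hnorm2_gt0/ltW//] := eqVneq x 0; rewrite hnorm2_0.
Qed.

Lemma hnorm2D x y :
  hnorm2 (x + y) = hnorm2 x + hnorm2 y + complex.Re (dot x y) *+ 2.
Proof.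
rewrite /hnorm2 dotDl !dotDr [dot y x]dotJ.
by case: (dot x x) (dot y y) (dot x y) => [a b] [c d] [e f] /=; ring.
Qed.

Lemma hnorm2Z (a : R[i]) x :
  hnorm2 (a *: x) = (complex.Re a ^+ 2 + complex.Im a ^+ 2) * hnorm2 x.
Proof.
rewrite {1}/hnorm2 dotZl dotZr -hnorm2C.
by case: a => [a b] /=; ring.
Qed.

Lemma hnorm2N x : hnorm2 (- x) = hnorm2 x.
Proof. by rewrite -scaleN1r hnorm2Z /=; ring. Qed.

Lemma hnorm2_le2 x y : hnorm2 (x + y) <= (hnorm2 x + hnorm2 y) *+ 2.
Proof.
have := hnorm2_ge0 (x - y).
rewrite !hnorm2D hnorm2N -scaleN1r dotZr.
case: (dot x y) => a b /=; lra.
Qed.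

Lemma Re_dot_le x y : `|complex.Re (dot x y)| <= hnorm2 x + hnorm2 y.
Proof.
have := hnorm2_ge0 (x - y); have := hnorm2_ge0 (x + y).
have := hnorm2_ge0 x; have := hnorm2_ge0 y.
rewrite !hnorm2D hnorm2N -scaleN1r dotZr ler_norml.
case: (dot x y) => a b /=; lra.
Qed.

Lemma Im_dot_le x y : `|complex.Im (dot x y)| <= hnorm2 x + hnorm2 y.
Proof.
have := Re_dot_le x ('i%C *: y).
rewrite dotZr hnorm2Z /=; case: (dot x y) => a b /=.
by rewrite !(expr0n, expr1n, mulr0, mul0r, mul1r, oppr0, mulN1r) /= !add0r opprK mul1r.
Qed.

Lemma hnorm2_sub x y z : hnorm2 (x - z) <= (hnorm2 (x - y) + hnorm2 (y - z)) *+ 2.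
Proof.
have -> : x - z = (x - y) + (y - z) by rewrite addrA subrK.
exact: hnorm2_le2.
Qed.

Lemma hnorm_ge0 x : 0 <= hnorm x. Proof. exact: sqrtr_ge0. Qed.

Lemma sqr_hnorm x : hnorm x ^+ 2 = hnorm2 x.
Proof. exact/sqr_sqrtr/hnorm2_ge0. Qed.

Lemma hnorm_lt x (e : R) : 0 < e -> (hnorm x < e) = (hnorm2 x < e ^+ 2).
Proof.
by move=> e0; rewrite -sqr_hnorm ltr_pXn2r ?nnegrE ?hnorm_ge0 ?ltW.
Qed.

Lemma hnorm_le x (e : R) : 0 <= e -> (hnorm x <= e) = (hnorm2 x <= e ^+ 2).
Proof. by move=> e0; rewrite -sqr_hnorm ler_pXn2r ?nnegrE ?hnorm_ge0. Qed.

Lemma hnorm_leD x y : hnorm (x + y) <= (hnorm x + hnorm y) *+ 2.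
Proof.
have := hnorm_ge0 x; have := hnorm_ge0 y => y0 x0.
rewrite hnorm_le; last by rewrite mulrn_wge0// addr_ge0.
apply: le_trans (hnorm2_le2 _ _) _; rewrite -!sqr_hnorm.
by rewrite -subr_ge0; have := mulr_ge0 x0 y0; have := sqr_ge0 (hnorm x);
  have := sqr_ge0 (hnorm y); nra.
Qed.

Lemma hnorm0 : hnorm (0 : V) = 0. Proof. by rewrite /hnorm hnorm2_0 sqrtr0. Qed.

Lemma hnormN x : hnorm (- x) = hnorm x. Proof. by rewrite /hnorm hnorm2N. Qed.

End PreHilbertTheory.

Section BoundedOperators.
Variables (R : realType) (V : preHilbertType R).

Definition is_bounded_linear (f : V -> V) : Prop :=
  (forall (a : R[i]) x y, f (a *: x + y) = a *: f x + f y) /\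
  exists M : R, forall x, hnorm (f x) <= M * hnorm x.

Record bop := Bop { bop_fun :> V -> V; bopP : is_bounded_linear bop_fun }.

Lemma bop_eq (A B : bop) : A =1 B -> A = B.
Proof.
case: A B => [f fP] [g gP] /= /funext fg; case: _ / fg in gP *.
by congr Bop; apply: Prop_irrelevance.
Qed.

Lemma bop_bound (A : bop) : exists2 M : R, 0 <= M & forall x, hnorm (A x) <= M * hnorm x.
Proof.
have [_ [M HM]] := bopP A; exists `|M| => // x.
by apply: le_trans (HM x) _; rewrite ler_wpM2r ?hnorm_ge0 ?ler_norm.
Qed.

Fact bop_zero_subproof : is_bounded_linear (fun=> 0).
Proof.
split=> [a x y|]; first by rewrite scaler0 addr0.
by exists 0 => x; rewrite hnorm0 mul0r.
Qed.

Fact bop_add_subproof (A B : bop) : is_bounded_linear (fun x => A x + B x).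
Proof.
split=> [a x y|].
  by rewrite (bopP A).1 (bopP B).1 scalerDr addrACA.
have [M M0 HM] := bop_bound A; have [N N0 HN] := bop_bound B.
exists ((M + N) *+ 2) => x; apply: le_trans (hnorm_leD _ _) _.
by rewrite mulrnAl lerMn2r /= mulrDl lerD.
Qed.

Fact bop_opp_subproof (A : bop) : is_bounded_linear (fun x => - A x).
Proof.
split=> [a x y|]; first by rewrite (bopP A).1 opprD scalerN.
by have [M M0 HM] := bop_bound A; exists M => x; rewrite hnormN.
Qed.

Fact bop_id_subproof : is_bounded_linear id.
Proof. by split=> //; exists 1 => x; rewrite mul1r. Qed.

Fact bop_comp_subproof (A B : bop) : is_bounded_linear (A \o B).
Proof.
split=> [a x y|] /=; first by rewrite (bopP B).1 (bopP A).1.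
have [M M0 HM] := bop_bound A; have [N N0 HN] := bop_bound B.
exists (M * N) => x; apply: le_trans (HM _) _.
by rewrite -mulrA ler_wpM2l.
Qed.

HB.instance Definition _ := gen_eqMixin bop.
HB.instance Definition _ := gen_choiceMixin bop.

Program Definition bop_zmodMixin := @GRing.isZmodule.Build bop
  (Bop bop_zero_subproof) (fun A => Bop (bop_opp_subproof A))
  (fun A B => Bop (bop_add_subproof A B)) _ _ _ _.
Next Obligation. by move=> A B D; apply: bop_eq => x /=; rewrite addrA. Qed.
Next Obligation. by move=> A B; apply: bop_eq => x /=; rewrite addrC. Qed.
Next Obligation. by move=> A; apply: bop_eq => x /=; rewrite add0r. Qed.
Next Obligation. by move=> A; apply: bop_eq => x /=; rewrite addNr. Qed.
HB.instance Definition _ := bop_zmodMixin.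

Lemma bopD (A : bop) x y : A (x + y) = A x + A y.
Proof. by have := (bopP A).1 1 x y; rewrite !scale1r. Qed.

Program Definition bop_ringMixin := @GRing.Zmodule_isPzRing.Build bop
  (Bop bop_id_subproof) (fun A B => Bop (bop_comp_subproof A B)) _ _ _ _ _.
Next Obligation. by move=> A B D; apply: bop_eq. Qed.
Next Obligation. by move=> A; apply: bop_eq. Qed.
Next Obligation. by move=> A; apply: bop_eq. Qed.
Next Obligation. by move=> A B D; apply: bop_eq. Qed.
Next Obligation. by move=> A B D; apply: bop_eq => x /=; rewrite bopD. Qed.
HB.instance Definition _ := bop_ringMixin.

End BoundedOperators.
Notation "''B' ( H )" := (bop H) (at level 8, format "''B' ( H )") : type_scope.
Section ComplexSeries.
Local Open Scope classical_set_scope.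
Variable R : realType.

(* Convergence of complex series, coordinatewise. *)
Definition csummable (u : nat -> R[i]) : Prop :=
  cvgn (series (fun n => complex.Re (u n))) /\
  cvgn (series (fun n => complex.Im (u n))).

Definition csum (u : nat -> R[i]) : R[i] :=
  limn (series (fun n => complex.Re (u n))) +i*
  limn (series (fun n => complex.Im (u n))).

Lemma csumD u v : csummable u -> csummable v ->
  csum (fun n => u n + v n) = csum u + csum v.
Proof.
move=> [u1 u2] [v1 v2]; rewrite /csum -[RHS]/(_ +i* _); congr (_ +i* _).
  rewrite -lim_seriesD//; congr (limn (series _)).
  by apply: funext => n /=; rewrite [RHS]/GRing.add /=; case: (u n) (v n) => [? ?] [? ?].
rewrite -lim_seriesD//; congr (limn (series _)).
by apply: funext => n /=; rewrite [RHS]/GRing.add /=; case: (u n) (v n) => [? ?] [? ?].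
Qed.

Lemma ReM (a b : R) (z : R[i]) :
  complex.Re ((a +i* b) * z) = a * complex.Re z + - b * complex.Im z.
Proof. by case: z => c d /=; rewrite mulNr. Qed.

Lemma ImM (a b : R) (z : R[i]) :
  complex.Im ((a +i* b) * z) = a * complex.Im z + b * complex.Re z.
Proof. by case: z. Qed.

Lemma lim_series_lin (f g : nat -> R) (a b : R) :
  cvgn (series f) -> cvgn (series g) ->
  limn (series (fun n => a * f n + b * g n)) =
  a * limn (series f) + b * limn (series g).
Proof.
move=> fc gc; have af := @is_cvg_seriesZ R f a fc.
have bg := @is_cvg_seriesZ R g b gc.
have := @lim_seriesD R _ _ af bg.
by rewrite (@lim_seriesZ R f a fc) (@lim_seriesZ R g b gc).
Qed.

Lemma csumZ a u : csummable u -> csum (fun n => a * u n) = a * csum u.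
Proof.
move=> [u1 u2]; rewrite /csum; case: a => a b.
rewrite [RHS](_ : _ = (a * limn (series (fun n => complex.Re (u n))) +
    - b * limn (series (fun n => complex.Im (u n)))) +i*
  (a * limn (series (fun n => complex.Im (u n))) +
    b * limn (series (fun n => complex.Re (u n))))); last first.
  by rewrite -[LHS]/(_ +i* _) mulNr.
rewrite -!lim_series_lin//; congr (_ +i* _); congr (limn (series _)).
  by apply: funext => n; exact: ReM.
by apply: funext => n; exact: ImM.
Qed.

Lemma csumJ u : csummable u -> csum (fun n => (u n)^*) = (csum u)^*.
Proof.
move=> [u1 u2]; rewrite /csum /= -lim_seriesN//.
congr (_ +i* _); congr (limn (series _)); apply: funext => n.
  by case: (u n).
by rewrite [RHS]/GRing.opp /=; case: (u n).
Qed.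

End ComplexSeries.

Section HilbertSum.
Local Open Scope classical_set_scope.
Variables (R : realType) (H : nat -> preHilbertType R).

(* The Hilbert space orthogonal direct sum of the [H n]: families with
   square-summable norms. *)
Definition hsummable (x : forall n, H n) : Prop :=
  cvgn (series (fun n => hnorm2 (x n))).

Record hsum := HSum { hcomp :> forall n, H n; hcompP : hsummable hcomp }.
Arguments hcompP : clear implicits.

Lemma hsum_eq (x y : hsum) : (forall n, x n = y n) -> x = y.
Proof.
case: x y => [x xP] [y yP] /= xy.
have {}xy : x = y by exact: functional_extensionality_dep.
by subst y; congr HSum; apply: Prop_irrelevance.
Qed.

Fact hsum_zero_subproof : hsummable (fun=> 0).
Proof.
rewrite /hsummable (_ : (fun n => _) = fun=> 0).
  by apply/cvg_ex; exists 0; rewrite /series /=;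
    under eq_fun do rewrite big1//; apply: cvg_cst.
by apply: funext => n; rewrite hnorm2_0.
Qed.

Fact hsum_add_subproof (x y : hsum) : hsummable (fun n => x n + y n).
Proof.
apply: (@series_le_cvg _ _ (fun n => 2 * hnorm2 (x n) + 2 * hnorm2 (y n))).
- by move=> n; apply: hnorm2_ge0.
- by move=> n; apply: addr_ge0; apply: mulr_ge0 => //; apply: hnorm2_ge0.
- by move=> n; apply: le_trans (hnorm2_le2 _ _) _; rewrite !mulr_natl -mulrnDl.
- have ax := @is_cvg_seriesZ R (fun n => hnorm2 (x n)) 2 (hcompP x).
  have ay := @is_cvg_seriesZ R (fun n => hnorm2 (y n)) 2 (hcompP y).
  have axy := @is_cvg_seriesD R _ _ ax ay.
  by have -> : (fun n => 2 * hnorm2 (x n) + 2 * hnorm2 (y n)) =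
    ((2 : R) *: (fun n => hnorm2 (x n) : R^o) + (2 : R) *: (fun n => hnorm2 (y n) : R^o)).
Qed.

Fact hsum_scale_subproof (a : R[i]) (x : hsum) : hsummable (fun n => a *: x n).
Proof.
rewrite /hsummable (_ : (fun n => _) =
  (complex.Re a ^+ 2 + complex.Im a ^+ 2) *: (fun n => hnorm2 (x n))).
  by apply: is_cvg_seriesZ; exact: hcompP.
by apply: funext => n; rewrite hnorm2Z.
Qed.

Fact hsum_opp_subproof (x : hsum) : hsummable (fun n => - x n).
Proof.
rewrite /hsummable (_ : (fun n => _) = (fun n => hnorm2 (x n))).
  exact: hcompP.
by apply: funext => n; rewrite hnorm2N.
Qed.

HB.instance Definition _ := gen_eqMixin hsum.
HB.instance Definition _ := gen_choiceMixin hsum.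

Program Definition hsum_zmodMixin := @GRing.isZmodule.Build hsum
  (HSum hsum_zero_subproof) (fun x => HSum (@hsum_opp_subproof x))
  (fun x y => HSum (@hsum_add_subproof x y)) _ _ _ _.
Next Obligation. by move=> x y z; apply: hsum_eq => n /=; rewrite addrA. Qed.
Next Obligation. by move=> x y; apply: hsum_eq => n /=; rewrite addrC. Qed.
Next Obligation. by move=> x; apply: hsum_eq => n /=; rewrite add0r. Qed.
Next Obligation. by move=> x; apply: hsum_eq => n /=; rewrite addNr. Qed.
HB.instance Definition _ := hsum_zmodMixin.

Program Definition hsum_lmodMixin := @GRing.Zmodule_isLmodule.Build R[i] hsum
  (fun a x => HSum (@hsum_scale_subproof a x)) _ _ _ _.
Next Obligation. by move=> a b x; apply: hsum_eq => n /=; rewrite scalerA. Qed.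
Next Obligation. by move=> x; apply: hsum_eq => n /=; rewrite scale1r. Qed.
Next Obligation. by move=> a x y; apply: hsum_eq => n /=; rewrite scalerDr. Qed.
Next Obligation. by move=> x a b; apply: hsum_eq => n /=; rewrite scalerDl. Qed.
HB.instance Definition _ := hsum_lmodMixin.

Definition hsum_dot (x y : hsum) : R[i] := csum (fun n => dot (x n) (y n)).

Lemma hsum_csummable (x y : hsum) : csummable (fun n => dot (x n) (y n)).
Proof.
have S : cvgn (series (fun n => hnorm2 (x n) + hnorm2 (y n))).
  by apply: (@is_cvg_seriesD _ (fun n => hnorm2 (x n)) (fun n => hnorm2 (y n)));
    exact: hcompP.
have P n : 0 <= hnorm2 (x n) + hnorm2 (y n) by rewrite addr_ge0 ?hnorm2_ge0.
split; apply: normed_cvg; apply: series_le_cvg S => // n /=; do ?exact: normr_ge0.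
- exact: Re_dot_le.
- exact: Im_dot_le.
Qed.

Lemma hsum_dot_ge (x : hsum) n :
  (\sum_(0 <= k < n) hnorm2 (x k))%:C <= hsum_dot x x.
Proof.
rewrite /hsum_dot /csum.
have -> : (fun n => complex.Im (dot (x n) (x n))) = fun=> 0.
  by apply: funext => k; rewrite -hnorm2C.
rewrite lecE /= /series /=.
under [X in limn X]eq_fun do rewrite big1//.
rewrite lim_cst// eqxx /=.
have C := hcompP x; apply: nondecreasing_cvgn_le C n.
by apply: nondecreasing_series => k _ _; apply: hnorm2_ge0.
Qed.

Program Definition hsum_preHilbertMixin := @Lmodule_isPreHilbert.Build R hsum
  hsum_dot _ _ _ _.
Next Obligation.
move=> x y z; rewrite /hsum_dot -csumD; do ?exact: hsum_csummable.
by congr csum; apply: funext => n; rewrite /= dotDl.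
Qed.
Next Obligation.
move=> a x z; rewrite /hsum_dot -csumZ; do ?exact: hsum_csummable.
by congr csum; apply: funext => n; rewrite /= dotZl.
Qed.
Next Obligation.
move=> x y; rewrite /hsum_dot -csumJ; do ?exact: hsum_csummable.
by congr csum; apply: funext => n; rewrite /= dotJ.
Qed.
Next Obligation.
move=> x x0; have [n xn0] : exists n, x n != 0.
  apply: contrapT => xn0; move/eqP: x0; apply; apply: hsum_eq => n /=.
  by apply: contrapT => /eqP xn; apply: xn0; exists n.
apply: lt_le_trans (hsum_dot_ge x n.+1).
rewrite ltcR big_nat_recr//= ltr_wpDl ?hnorm2_gt0//.
by apply: sumr_ge0 => k _; apply: hnorm2_ge0.
Qed.
HB.instance Definition _ := hsum_preHilbertMixin.

Lemma hsum_hnorm2 (x : hsum) : hnorm2 x = limn (series (fun n => hnorm2 (x n))).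
Proof. by []. Qed.

Lemma hsum_hnorm2_ge (x : hsum) n :
  \sum_(0 <= k < n) hnorm2 (x k) <= hnorm2 x.
Proof. by have := hsum_dot_ge x n; rewrite lecE => /andP[]. Qed.

Lemma hcomp_sub (x y : hsum) n : (x - y) n = x n - y n.
Proof. by []. Qed.

(* The family with [v] in degree [n] and [0] elsewhere. *)
Definition hinj_fun n (v : H n) (m : nat) : H m :=
  if @eqP _ n m is ReflectT e then ecast k (H k) e v else 0.

Lemma hinj_fun_eq n (v : H n) : hinj_fun v n = v.
Proof. by rewrite /hinj_fun; case: eqP => // e; rewrite eq_axiomK. Qed.

Lemma hinj_fun_neq n (v : H n) m : n <> m -> hinj_fun v m = 0.
Proof. by rewrite /hinj_fun; case: eqP. Qed.

Fact hinj_subproof n (v : H n) : hsummable (hinj_fun v).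
Proof.
apply/cvg_ex; exists (hnorm2 v).
apply: (@cvg_near_cst _ _ _ _ _ _ _).
exists n.+1 => // m /= nm; rewrite /series /=.
rewrite (bigD1_seq n) ?iota_uniq ?mem_index_iota//= hinj_fun_eq big1 ?addr0//.
by move=> k /eqP kn; rewrite hinj_fun_neq ?hnorm2_0// => e; apply: kn.
Qed.

Definition hinj n (v : H n) : hsum := HSum (@hinj_subproof n v).

Lemma lim_series_single (f : nat -> R) n :
  (forall k, k <> n -> f k = 0) -> limn (series f) = f n.
Proof.
move=> f0; apply: cvg_lim => //; apply: cvg_near_cst.
exists n.+1 => // m /= nm; rewrite /series /=.
rewrite (bigD1_seq n) ?iota_uniq ?mem_index_iota//= big1 ?addr0//.
by move=> k /eqP kn; apply: f0.
Qed.

Lemma dot_hinj n (v w : H n) : dot (hinj v) (hinj w) = dot v w.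
Proof.
rewrite [LHS]/(csum _) /csum !(@lim_series_single _ n) /= ?hinj_fun_eq.
- by case: (dot v w).
- by move=> k kn; rewrite hinj_fun_neq ?dot0l// => e; apply: kn.
- by move=> k kn; rewrite hinj_fun_neq ?dot0l// => e; apply: kn.
Qed.

Lemma dot_hinj_neq n m (v : H n) (w : H m) : n <> m -> dot (hinj v) (hinj w) = 0.
Proof.
move=> nm.
have z k : dot (hinj_fun v k) (hinj_fun w k) = 0.
  have [nk|/eqP nk] := eqVneq n k; last by rewrite hinj_fun_neq// dot0l.
  have mk : m <> k by rewrite -nk => e; apply: nm.
  by rewrite [X in dot _ X](hinj_fun_neq w mk) dot0r.
rewrite [LHS]/(csum _) /csum !(@lim_series_single _ n).
- by rewrite z.
- by move=> k _; rewrite z.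
- by move=> k _; rewrite z.
Qed.

End HilbertSum.
Arguments hcompP {R H} h.

Section HilbertSumComplete.
Local Open Scope classical_set_scope.
Variables (R : realType) (H : nat -> hilbertType R).
Local Notation hsum := (hsum H).

Lemma hsum_complete (x : nat -> hsum) :
  (forall e : R, 0 < e -> exists N, forall m n, (N <= m)%N -> (N <= n)%N ->
     hnorm (x m - x n) < e) ->
  exists l : hsum, forall e : R, 0 < e -> exists N, forall n, (N <= n)%N ->
    hnorm (x n - l) < e.
Proof.
move=> xC.
have le_hnorm2 (y : hsum) n : hnorm2 (y n) <= hnorm2 y.
  apply: le_trans (hsum_hnorm2_ge y n.+1); rewrite big_nat_recr//= lerDr.
  by apply: sumr_ge0 => k _; apply: hnorm2_ge0.
have exl : forall j, exists l : H j, forall e : R, 0 < e ->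
    exists N, forall k, (N <= k)%N -> hnorm (x k j - l) < e.
  move=> j; apply: hcomplete => e e0; have [N NP] := xC e e0.
  exists N => a b Na Nb; have := NP _ _ Na Nb; rewrite !hnorm_lt//.
  exact/le_lt_trans/(le_hnorm2 (x a - x b)).
pose l j := projT1 (cid (exl j)).
have lP j : forall e : R, 0 < e ->
    exists N, forall k, (N <= k)%N -> hnorm (x k j - l j) < e.
  exact: projT2 (cid (exl j)).
have xl e : 0 < e -> exists N, forall k, (N <= k)%N -> forall n,
    \sum_(0 <= j < n) hnorm2 (x k j - l j) <= e.
  move=> e0; pose f := Num.sqrt (e / 4).
  have f0 : 0 < f by rewrite sqrtr_gt0 divr_gt0.
  have ff : f ^+ 2 = e / 4 by rewrite sqr_sqrtr// divr_ge0// ltW.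
  have [N NP] := xC f f0; exists N => k Nk n.
  pose g := Num.sqrt (e / 4 / n.+1%:R).
  have g0 : 0 < g by rewrite sqrtr_gt0 !divr_gt0.
  have gg : g ^+ 2 = e / 4 / n.+1%:R by rewrite sqr_sqrtr// !divr_ge0// ltW.
  have /choice[M MP] : forall j, exists M, forall k, (M <= k)%N ->
      hnorm (x k j - l j) < g by move=> j; exact: lP.
  pose m := (N + \sum_(j < n) M j)%N.
  have mk : hnorm2 (x k - x m) <= e / 4.
    by rewrite -ff ltW// -hnorm_lt//; apply: NP => //; rewrite leq_addr.
  have ml (j : 'I_n) : hnorm2 (x m j - l j) <= e / 4 / n.+1%:R.
    rewrite -gg ltW// -hnorm_lt//; apply: MP.
    by rewrite /m (bigD1 j)//= addnCA leq_addr.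
  rewrite big_mkord; apply: (@le_trans _ _ (\sum_(j < n)
    ((hnorm2 (x k j - x m j) + e / 4 / n.+1%:R) *+ 2))).
    apply: ler_sum => j _; apply: le_trans (hnorm2_sub _ (x m j) _) _.
    by rewrite lerMn2r /= lerD2l ml.
  rewrite sumrMnl big_split /= sumr_const card_ord.
  have : \sum_(j < n) hnorm2 (x k j - x m j) <= e / 4.
    by apply: le_trans mk; have := hsum_hnorm2_ge (x k - x m) n; rewrite big_mkord.
  have : (e / 4 / n.+1%:R) *+ n <= e / 4.
    rewrite -mulr_natr mulrAC -mulrA ler_piMr ?divr_ge0 ?(ltW e0)//.
    by rewrite ler_pdivrMr// mul1r ler_nat.
  rewrite mulrnDl; set a := _ *+ n; set b := \sum_(_ < _) _; lra.
have nd k : nondecreasing_seq (series (fun j => hnorm2 (x k j - l j))).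
  by apply: nondecreasing_series => j _ _; apply: hnorm2_ge0.
have [N0 N0P] := xl 1 ltr01.
have xlS k : (N0 <= k)%N -> hsummable (fun j => x k j - l j).
  move=> Nk; apply: nondecreasing_is_cvgn (nd k) _.
  by exists 1 => _ [n _ <-]; apply: N0P.
pose L : hsum := x N0 - HSum (xlS N0 (leqnn N0)).
have LE j : L j = l j by rewrite /L hcomp_sub /= opprB addrC subrK.
exists L => e e0; have e20 : 0 < e ^+ 2 / 2 by rewrite divr_gt0 ?exprn_gt0.
have [N NP] := xl _ e20; exists (maxn N0 N) => k; rewrite geq_max => /andP[N0k Nk].
rewrite hnorm_lt// hsum_hnorm2; apply: (@le_lt_trans _ _ (e ^+ 2 / 2)); last first.
  by rewrite ltr_pdivrMr// ltr_pMr ?exprn_gt0// ltr1n.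
apply: limr_le; first exact: (hcompP (x k - L)).
apply: nearW => n; apply: le_trans (NP k Nk n).
by rewrite le_eqVlt; apply/orP; left; apply/eqP; apply: eq_bigr => j _;
  rewrite hcomp_sub LE.
Qed.

HB.instance Definition _ := PreHilbert_isComplete.Build R hsum hsum_complete.

End HilbertSumComplete.

Section QTensors.
Variables (R : realType) (d : nat) (q : R).

Definition inversions n (s : 'S_n) : nat :=
  #|[set p : 'I_n * 'I_n | (p.1 < p.2)%N && (s p.2 < s p.1)%N]|.

(* The q-inner product of the basis vectors [e_u = e_(u 0) (x) ... (x) e_(u (n-1))]
   and [e_v] of [(C^d)^{(x) n}]. *)
Definition word_dot n (u v : n.-tuple 'I_d) : R :=
  \sum_(s : 'S_n) q ^+ inversions s * \prod_(i < n) (tnth u i == tnth v (s i))%:R.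

(* A tensor is given by its coordinates in the basis [e_u], indexed by words [u]
   of length [n] over ['I_d]; in particular degree [0] is [C]. The form is the
   sesquilinear extension of [word_dot]; see [q_dot_simple] for its value on
   simple tensors. *)
Definition q_dot n (x y : {ffun n.-tuple 'I_d -> R[i]}) : R[i] :=
  \sum_u \sum_v x u * (y v)^* * (word_dot u v)%:C.

Definition simple_tensor n (v : n.-tuple 'rV[R[i]]_d) : {ffun n.-tuple 'I_d -> R[i]} :=
  [ffun u => \prod_(i < n) (tnth v i) 0 (tnth u i)].

Definition tuple_act n (s : 'S_n) (u : n.-tuple 'I_d) : n.-tuple 'I_d :=
  [tuple tnth u (s i) | i < n].

Lemma tuple_actM n (s t : 'S_n) u : tuple_act s (tuple_act t u) = tuple_act (s * t)%g u.
Proof. by apply: eq_from_tnth => i; rewrite !tnth_mktuple permM. Qed.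

Lemma tuple_act1 n u : tuple_act (1 : 'S_n)%g u = u.
Proof. by apply: eq_from_tnth => i; rewrite !tnth_mktuple perm1. Qed.

Lemma tuple_actK n (s : 'S_n) : cancel (tuple_act s) (tuple_act s^-1%g).
Proof. by move=> u; rewrite tuple_actM mulVg tuple_act1. Qed.

Lemma tuple_actVK n (s : 'S_n) : cancel (tuple_act s^-1%g) (tuple_act s).
Proof. by move=> u; rewrite tuple_actM mulgV tuple_act1. Qed.

Lemma word_dotE n (u v : n.-tuple 'I_d) :
  word_dot u v = \sum_(s : 'S_n) q ^+ inversions s * (u == tuple_act s v)%:R.
Proof.
apply: eq_bigr => s _; congr (_ * _).
have [->|uv] := eqVneq u (tuple_act s v).
  by rewrite big1// => i _; rewrite tnth_mktuple eqxx.
have [i ui] : exists i, tnth u i != tnth v (s i).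
  apply/existsP; apply: contra_neqT uv; rewrite negb_exists => /forallP uv.
  by apply: eq_from_tnth => i; rewrite tnth_mktuple; apply/eqP/negPn/uv.
by rewrite (bigD1 i)//= (negbTE ui) mul0r.
Qed.

Lemma q_dotE n (x y : {ffun n.-tuple 'I_d -> R[i]}) :
  q_dot x y = \sum_(s : 'S_n) (q ^+ inversions s)%:C *
                \sum_v x (tuple_act s v) * (y v)^*.
Proof.
rewrite /q_dot exchange_big /=.
under [RHS]eq_bigr do rewrite mulr_sumr.
rewrite [RHS]exchange_big /=; apply: eq_bigr => v _.
under eq_bigr do rewrite word_dotE rmorph_sum /= mulr_sumr.
rewrite exchange_big /=; apply: eq_bigr => s _.
rewrite (bigD1 (tuple_act s v))//= eqxx big1 ?addr0.
  by rewrite mulr1 mulrC.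
by move=> u /negbTE ->; rewrite mulr0 rmorph0 mulr0.
Qed.

Definition cdot (v w : 'rV[R[i]]_d) : R[i] := \sum_(a < d) v 0 a * (w 0 a)^*.

Lemma q_dot_simple n (v w : n.-tuple 'rV[R[i]]_d) :
  q_dot (simple_tensor v) (simple_tensor w) =
  \sum_(s : 'S_n) (q ^+ inversions s)%:C * \prod_(i < n) cdot (tnth v i) (tnth w (s i)).
Proof.
rewrite q_dotE; apply: eq_bigr => s _; congr (_ * _).
rewrite /cdot bigA_distr_bigA /=.
rewrite (reindex (fun f : {ffun 'I_n -> 'I_d} => tuple_act s^-1%g [tuple f i | i < n])) /=.
  apply: eq_bigr => f _; rewrite tuple_actVK !ffunE big_split /=; congr (_ * _).
    by apply: eq_bigr => i _; rewrite tnth_mktuple.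
  rewrite rmorph_prod (reindex_inj (@perm_inj _ s)) /=.
  by apply: eq_bigr => i _; rewrite !tnth_mktuple permK.
exists (fun u => [ffun i => tnth (tuple_act s u) i]) => [f|u] _.
  by apply/ffunP => i; rewrite ffunE tuple_actVK tnth_mktuple.
rewrite -[RHS](tuple_actK s); congr (tuple_act _ _).
by apply: eq_from_tnth => i; rewrite tnth_mktuple ffunE.
Qed.

End QTensors.

Section Inversions.
Variable n : nat.
Implicit Types (s a b : 'S_n).

Definition invb s (p : 'I_n * 'I_n) : bool := (p.1 < p.2)%N && (s p.2 < s p.1)%N.

Lemma card_sym_pairs (e : pred ('I_n * 'I_n)) :
  (forall i j, e (i, j) = e (j, i)) -> (forall i, ~~ e (i, i)) ->
  #|[set p | e p]| = (#|[set p : 'I_n * 'I_n | (p.1 < p.2)%N && e p]|).*2.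
Proof.
move=> esym eirr; pose sw (p : 'I_n * 'I_n) := (p.2, p.1).
have swK : involutive sw by case.
rewrite -(cardsID [set p : 'I_n * 'I_n | (p.1 < p.2)%N]) -addnn; congr (_ + _)%N.
  by apply: eq_card => p; rewrite !inE andbC.
rewrite -(card_imset _ (inv_inj swK)); apply: eq_card => p; apply/imsetP/idP.
  move=> [[i j]]; rewrite !inE /= -leqNgt => /andP[ji eij] -> /=.
  rewrite -esym eij andbT ltn_neqAle ji andbT.
  by apply: contraTN eij => /eqP/ord_inj ->; apply: eirr.
case: p => i j; rewrite inE /= => /andP[ij eij]; exists (j, i) => //.
by rewrite !inE /= -esym eij andbT -leqNgt ltnW.
Qed.

Lemma perm_ltn_swap s i j : i != j -> (s j < s i)%N = ~~ (s i < s j)%N.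
Proof.
move=> ij; rewrite -leqNgt [RHS]leq_eqVlt (inj_eq (@ord_inj n)) (inj_eq (@perm_inj _ s)).
by rewrite eq_sym (negbTE ij).
Qed.

Lemma inversionsE a b :
  inversions (a^-1 * b)%g = #|[set p | invb a p != invb b p]|.
Proof.
pose e1 (p : 'I_n * 'I_n) := (p.1 < p.2)%N != ((a^-1 * b)%g p.1 < (a^-1 * b)%g p.2)%N.
pose e2 (p : 'I_n * 'I_n) := (a p.1 < a p.2)%N != (b p.1 < b p.2)%N.
have ltsw (i j : 'I_n) : i != j -> (j < i)%N = ~~ (i < j)%N.
  by move=> ij; have := perm_ltn_swap 1%g ij; rewrite !perm1.
have D1 : #|[set p | e1 p]| = (inversions (a^-1 * b)%g).*2.
  rewrite card_sym_pairs => [|i j|i]; last 2 first.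
  - rewrite /e1 /=; have [->//|ij] := eqVneq i j.
    rewrite (ltsw _ _ ij) (perm_ltn_swap _ ij).
    by rewrite (inj_eq negb_inj).
  - by rewrite /e1 /= !ltnn.
  congr _.*2; apply: eq_card => -[i j]; rewrite !inE /e1 /=.
  have [ij|//] := boolP (i < j)%N.
  rewrite [in RHS]perm_ltn_swap; last by apply: contraTneq ij => ->; rewrite ltnn.
  by case: (_ < _)%N.
have D2 : #|[set p | e2 p]| = (#|[set p | invb a p != invb b p]|).*2.
  rewrite card_sym_pairs => [|i j|i]; last 2 first.
  - rewrite /e2 /=; have [->//|ij] := eqVneq i j.
    rewrite (perm_ltn_swap a ij) (perm_ltn_swap b ij).
    by rewrite (inj_eq negb_inj).
  - by rewrite /e2 /= !ltnn.
  congr _.*2; apply: eq_card => -[i j]; rewrite !inE /e2 /invb /=.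
  have [ij|//] := boolP (i < j)%N.
  have nij : i != j by apply: contraTneq ij => ->; rewrite ltnn.
  rewrite !(perm_ltn_swap _ nij).
  by rewrite (inj_eq negb_inj).
apply: double_inj; rewrite -D1 -D2.
have injf : injective (fun p : 'I_n * 'I_n => (a p.1, a p.2)).
  by move=> [i j] [k l] [/perm_inj -> /perm_inj ->].
rewrite -[RHS](card_imset _ injf); apply: eq_card => -[i j]; apply/idP/imsetP.
  rewrite inE => eij; exists ((a^-1)%g i, (a^-1)%g j); last by rewrite /= !permKV.
  by move: eij; rewrite inE /e1 /e2 /= !permKV !permM.
by move=> [[k l]]; rewrite inE /e2 /= => ekl [-> ->]; rewrite inE /e1 /= !permM !permK.
Qed.

Lemma invb_inj a b : invb a =1 invb b -> a = b.
Proof.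
move=> ab.
have lt_ab i j : (a i < a j)%N = (b i < b j)%N.
  have [->|nij] := eqVneq i j; first by rewrite !ltnn.
  wlog ij : i j nij / (i < j)%N => [W|].
    have [/W|] := ltnP i j; first exact.
    rewrite leq_eqVlt => /orP[/eqP/ord_inj e|ji]; first by rewrite e eqxx in nij.
    have nji : j != i by rewrite eq_sym.
    by rewrite (perm_ltn_swap a nji) (perm_ltn_swap b nji) (W j i).
  have := ab (i, j); rewrite /invb /= ij /= (perm_ltn_swap a nij) (perm_ltn_swap b nij).
  exact: negb_inj.
have cnt s i : #|[set j | (s j < s i)%N]| = s i.
  have winj : injective (widen_ord (ltnW (ltn_ord (s i)))).
    by move=> k l /(congr1 val)/= kl; apply: val_inj.
  rewrite -(card_imset _ (@perm_inj _ s)) -[RHS]card_ord -(card_imset _ winj).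
  apply: eq_card => k; apply/imsetP/imsetP.
    move=> [j]; rewrite inE => ji ->; exists (Ordinal ji) => //; exact: val_inj.
  move=> [j _ ->]; exists ((s^-1)%g (widen_ord (ltnW (ltn_ord (s i))) j)).
    by rewrite inE permKV /=.
  by rewrite permKV.
apply/permP => i; apply: val_inj; rewrite /= -(cnt a i) -(cnt b i).
by apply: eq_card => j; rewrite !inE lt_ab.
Qed.

End Inversions.

Lemma conj_realM (R : realType) (r : R) (z : R[i]) : (r%:C * z)^* = r%:C * z^*.
Proof. by rewrite rmorphM; congr (_ * _); apply: conjc_real. Qed.

Section Positivity.
Variables (R : realType) (d : nat) (q : R) (n : nat).
Hypothesis hq : -1 < q < 1.
Local Notation pairs := ('I_n * 'I_n)%type.
Local Notation word := (n.-tuple 'I_d).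

Let wt (c : bool) : R := if c then (1 - q) / 2 else (1 + q) / 2.
Let chi (c b : bool) : R := (-1) ^+ (c && b).
Let X (C : {ffun pairs -> bool}) (s : 'S_n) : R := \prod_p chi (C p) (invb s p).

Lemma q_inversionsE (a b : 'S_n) :
  q ^+ inversions (a^-1 * b)%g =
  \sum_(C : {ffun pairs -> bool}) (\prod_p wt (C p)) * X C a * X C b.
Proof.
transitivity (\prod_p \sum_(c : bool) wt c * chi c (invb a p) * chi c (invb b p)).
  rewrite inversionsE -prodr_const big_mkcond /=.
  apply: eq_bigr => p _; rewrite inE big_bool /wt /chi /=.
  by case: (invb a p) (invb b p) => [] [] /=; rewrite ?expr0 ?expr1; lra.
rewrite bigA_distr_bigA /=; apply: eq_bigr => C _.
by rewrite !big_split.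
Qed.

Lemma sum_chi (a b : 'S_n) :
  \sum_(C : {ffun pairs -> bool}) X C a * X C b = (a == b)%:R * 2 ^+ #|{: pairs}|.
Proof.
transitivity (\prod_p \sum_(c : bool) chi c (invb a p) * chi c (invb b p)).
  by rewrite bigA_distr_bigA /=; apply: eq_bigr => C _; rewrite big_split.
have [<-|ab] := eqVneq a b.
  rewrite mul1r -prodr_const; apply: eq_bigr => p _.
  by rewrite big_bool /chi /=; case: (invb a p); rewrite ?expr0 ?expr1; lra.
have [p abp] : exists p, invb a p != invb b p.
  apply/existsP; apply: contra_neqT ab; rewrite negb_exists => /forallP ab.
  by apply: invb_inj => p; apply/eqP/negPn/ab.
rewrite (bigD1 p)//= big_bool /chi /= mul0r.
case: (invb a p) (invb b p) abp => [] [] //= _; rewrite ?expr0 ?expr1;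
  by rewrite [X in X * _](_ : _ = 0) ?mul0r//; lra.
Qed.

Variable x : {ffun word -> R[i]}.
Let Y (a : 'S_n) (w : word) := x (tuple_act a^-1%g w).

Lemma q_dot_avg :
  (n`!)%:R * q_dot q x x =
  \sum_w \sum_(C : {ffun pairs -> bool}) (\prod_p wt (C p))%:C *
    `|\sum_a (X C a)%:C * Y a w| ^+ 2.
Proof.
have -> : (n`!)%:R * q_dot q x x = \sum_(b : 'S_n) \sum_(a : 'S_n)
    (q ^+ inversions (a^-1 * b)%g)%:C * \sum_w Y a w * (Y b w)^*.
  rewrite -card_Sn -sum1_card natr_sum mulr_suml.
  apply: eq_bigr => b _; rewrite mul1r q_dotE.
  rewrite (reindex (fun a : 'S_n => a^-1 * b)%g) /=; last first.
    exists (fun s : 'S_n => b * s^-1)%g => s _; rewrite invMg ?invgK ?mulKVg ?mulgA ?mulgV ?mul1g//.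
    by rewrite mulgKV.
  apply: eq_bigr => a _; congr (_ * _).
  rewrite (reindex_inj (can_inj (tuple_actVK b))) /=.
  by apply: eq_bigr => w _; rewrite tuple_actM mulgK.
under eq_bigr do under eq_bigr do rewrite mulr_sumr.
under eq_bigr do rewrite exchange_big /=.
rewrite exchange_big /=; apply: eq_bigr => w _.
under eq_bigr do under eq_bigr do rewrite q_inversionsE rmorph_sum mulr_suml.
under eq_bigr do rewrite exchange_big /=.
rewrite exchange_big /=; apply: eq_bigr => C _.
rewrite sqr_normc rmorph_sum mulr_sumr mulr_sumr.
apply: eq_bigr => b _; rewrite mulr_suml mulr_sumr; apply: eq_bigr => a _.
by rewrite /= conj_realM !rmorphM /=; ring.
Qed.

(* Positive definiteness comes from writing the kernel [q ^+ inversions (a^-1 * b)]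
   as a combination, with positive weights, of products of characters evaluated at
   the inversion sets of [a] and [b]. *)
Lemma q_dot_lower :
  ((1 - `|q|) ^+ #|{: pairs}|)%:C * \sum_w `|x w| ^+ 2 <= q_dot q x x.
Proof.
have [q1 q2] := andP hq; set N := #|{: pairs}|.
have fac0 : (0 : R[i]) < (n`!)%:R by rewrite ltr0n fact_gt0.
rewrite -(ler_pM2l fac0) q_dot_avg.
have q3 : 0 < 1 - `|q| by rewrite subr_gt0 ltr_norml q1.
pose m := (1 - `|q|) / 2; have m0 : 0 < m by rewrite divr_gt0.
have wtm c : m <= wt c.
  rewrite /m /wt; have := ler_norm q; have := ler_norm (- q); rewrite normrN.
  by case: c => *; rewrite ler_pM2r ?invr_gt0//; lra.
apply: (@le_trans _ _ (\sum_w \sum_(C : {ffun pairs -> bool})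
    (m ^+ N)%:C * `|\sum_a (X C a)%:C * Y a w| ^+ 2)); last first.
  apply: ler_sum => w _; apply: ler_sum => C _; apply: ler_wpM2r.
    by rewrite exprn_ge0.
  rewrite lecR -prodr_const; apply: ler_prod => p _.
  by rewrite wtm ltW.
have sumY w : \sum_(C : {ffun pairs -> bool}) `|\sum_a (X C a)%:C * Y a w| ^+ 2 =
    (2 ^+ N)%:C * \sum_a `|Y a w| ^+ 2.
  transitivity (\sum_a \sum_b Y a w * (Y b w)^* *
      (\sum_(C : {ffun pairs -> bool}) X C a * X C b)%:C).
    under eq_bigr do rewrite sqr_normc rmorph_sum mulr_suml.
    rewrite exchange_big /=; apply: eq_bigr => a _.
    under eq_bigr do rewrite mulr_sumr.
    rewrite exchange_big /=; apply: eq_bigr => b _.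
    rewrite rmorph_sum mulr_sumr; apply: eq_bigr => C _.
    by rewrite /= conj_realM !rmorphM /=; ring.
  rewrite mulr_sumr; apply: eq_bigr => a _.
  under eq_bigr do rewrite sum_chi.
  rewrite (bigD1 a)//= big1 ?addr0.
    by rewrite eqxx mul1r sqr_normc mulrC.
  by move=> b ba; rewrite eq_sym (negbTE ba) mul0r rmorph0 mulr0.
under [leRHS]eq_bigr do rewrite -mulr_sumr sumY mulrA.
rewrite -mulr_sumr exchange_big /=.
have -> : \sum_(a : 'S_n) \sum_w `|Y a w| ^+ 2 = (n`!)%:R * \sum_w `|x w| ^+ 2.
  rewrite -card_Sn -sum1_card natr_sum mulr_suml.
  apply: eq_bigr => a _; rewrite mul1r.
  by rewrite [RHS](reindex_inj (can_inj (tuple_actVK a))).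
rewrite mulrCA -rmorphM -exprMn /m divfK// mulrCA lexx.
Qed.

End Positivity.

Definition q_tensor (R : realType) (d : nat) (q : R) (hq : -1 < q < 1) (n : nat) : Type :=
  {ffun n.-tuple 'I_d -> R[i]}.

Section QTensorHilbert.
Variables (R : realType) (d : nat) (q : R) (hq : -1 < q < 1) (n : nat).
Local Notation T := (q_tensor d hq n).

HB.instance Definition _ := GRing.Lmodule.copy T {ffun n.-tuple 'I_d -> R[i]}.

Lemma inversionsV (s : 'S_n) : inversions s^-1%g = inversions s.
Proof.
rewrite -[s^-1%g]mulg1 -[in RHS](mul1g s) -[in RHS](invg1 (perm_of 'I_n)) !inversionsE.
by apply: eq_card => p; rewrite !inE eq_sym.
Qed.

Lemma word_dotC (u v : n.-tuple 'I_d) : word_dot q u v = word_dot q v u.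
Proof.
rewrite !word_dotE (reindex_inj invg_inj) /=; apply: eq_bigr => s _.
rewrite inversionsV; congr (_ * _%:R); congr (nat_of_bool _).
by apply/eqP/eqP => ->; rewrite ?tuple_actVK ?tuple_actK.
Qed.

Lemma q_dot_gt0 (x : T) : x != 0 -> 0 < q_dot q x x.
Proof.
move=> x0; have [u xu] : exists u, x u != 0.
  apply/existsP; apply: contra_neqT x0; rewrite negb_exists => /forallP x0.
  by apply/ffunP => u; rewrite ffunE; apply/eqP/negPn/x0.
apply: lt_le_trans (q_dot_lower hq x); apply: mulr_gt0.
  by rewrite ltcR exprn_gt0// subr_gt0 ltr_norml.
rewrite (bigD1 u)//= ltr_pwDl ?exprn_gt0 ?normr_gt0//.
by apply: sumr_ge0 => w _; rewrite exprn_ge0.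
Qed.

Program Definition q_tensor_preHilbertMixin :=
  @Lmodule_isPreHilbert.Build R T (fun x y => q_dot q x y) _ _ _ _.
Next Obligation.
move=> x y z; rewrite /q_dot -big_split; apply: eq_bigr => u _.
by rewrite -big_split; apply: eq_bigr => v _; rewrite ffunE !mulrDl.
Qed.
Next Obligation.
move=> a x z; rewrite /q_dot mulr_sumr; apply: eq_bigr => u _.
by rewrite mulr_sumr; apply: eq_bigr => v _; rewrite ffunE -!mulrA.
Qed.
Next Obligation.
move=> x y; rewrite /q_dot exchange_big rmorph_sum; apply: eq_bigr => u _.
rewrite rmorph_sum; apply: eq_bigr => v _.
rewrite /= [X in _ = X^*]mulrC conj_realM rmorphM word_dotC /=.
rewrite [LHS]mulrC [y v * _]mulrC; congr (_ * (_ * _)); exact: esym (conjcK _).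
Qed.
Next Obligation. by move=> x; apply: q_dot_gt0. Qed.
HB.instance Definition _ := q_tensor_preHilbertMixin.

Lemma hnorm2_coord (x : T) u :
  (1 - `|q|) ^+ #|{: 'I_n * 'I_n}| * (complex.Re (x u) ^+ 2 + complex.Im (x u) ^+ 2)
  <= hnorm2 x.
Proof.
rewrite -lecR hnorm2C rmorphM /= add_Re2_Im2; apply: le_trans (q_dot_lower hq x).
apply: ler_wpM2l.
  by rewrite ler0c exprn_ge0// subr_ge0 ltW// ltr_norml.
rewrite (bigD1 u)//= lerDl.
by apply: sumr_ge0 => w _; rewrite exprn_ge0.
Qed.

Lemma hnorm_sum_cvg (I : Type) (r : seq I) (f : I -> nat -> T) :
  (forall i (e : R), 0 < e -> exists N, forall k, (N <= k)%N -> hnorm (f i k) < e) ->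
  forall e : R, 0 < e -> exists N, forall k, (N <= k)%N ->
    hnorm (\sum_(i <- r) f i k) < e.
Proof.
move=> fc; elim: r => [|i r IH] e e0.
  by exists 0 => k _; rewrite big_nil hnorm0.
have e40 : 0 < e / 4 by rewrite divr_gt0.
have [N NP] := fc i _ e40; have [M MP] := IH _ e40.
exists (maxn N M) => k; rewrite geq_max => /andP[Nk Mk].
rewrite big_cons; apply: le_lt_trans (hnorm_leD _ _) _.
have := NP _ Nk; have := MP _ Mk; set a := hnorm _; set b := hnorm _; lra.
Qed.

Lemma cauchy_real (x : nat -> R) :
  (forall e : R, 0 < e -> exists N, forall a b, (N <= a)%N -> (N <= b)%N ->
     `|x a - x b| < e) ->
  exists l : R, forall e : R, 0 < e -> exists N, forall k, (N <= k)%N -> `|x k - l| < e.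
Proof.
move=> xC.
have /cvg_ex[l xl] : cvgn x.
  apply/cauchy_cvgP/cauchy_ballP => e e0; have [N NP] := xC e e0.
  rewrite near_map2; exists ([set k | (N <= k)%N], [set k | (N <= k)%N])%classic.
    by split; exists N.
  by move=> [a b] [/= Na Nb]; apply: NP.
exists l => e e0; move/cvgrPdist_lt: xl => /(_ e e0)[N _ NP].
by exists N => k Nk; rewrite distrC; apply: NP.
Qed.

Lemma q_tensor_complete (x : nat -> T) :
  (forall e : R, 0 < e -> exists N, forall m n, (N <= m)%N -> (N <= n)%N ->
     hnorm (x m - x n) < e) ->
  exists l : T, forall e : R, 0 < e -> exists N, forall n, (N <= n)%N ->
    hnorm (x n - l) < e.
Proof.
move=> xC; set c := (1 - `|q|) ^+ #|{: 'I_n * 'I_n}|.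
have c0 : 0 < c by rewrite exprn_gt0// subr_gt0 ltr_norml.
have coordC u (e : R) : 0 < e -> exists N, forall a b, (N <= a)%N -> (N <= b)%N ->
    complex.Re (x a u - x b u) ^+ 2 + complex.Im (x a u - x b u) ^+ 2 < e ^+ 2.
  move=> e0; pose f := Num.sqrt (c * e ^+ 2).
  have ce0 : 0 < c * e ^+ 2 by apply: mulr_gt0 => //; apply: exprn_gt0.
  have f0 : 0 < f by rewrite sqrtr_gt0.
  have [N NP] := xC f f0; exists N => a b Na Nb.
  have := NP a b Na Nb; rewrite hnorm_lt// (sqr_sqrtr (ltW ce0)).
  move=> /(le_lt_trans (hnorm2_coord (x a - x b) u)).
  by rewrite ltr_pM2l// !ffunE.
have lt_sqr (a e : R) : 0 < e -> a ^+ 2 < e ^+ 2 -> `|a| < e.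
  by move=> e0 ae; rewrite -(@ltr_pXn2r _ 2) ?nnegrE ?(ltW e0)// real_normK ?num_real.
have exl u : exists l : R[i], forall e : R, 0 < e -> exists N, forall k, (N <= k)%N ->
    `|x k u - l| < e%:C.
  have [|a aP] := @cauchy_real (fun k => complex.Re (x k u)).
    move=> e e0; have [N NP] := coordC u e e0; exists N => a b Na Nb.
    apply: lt_sqr => //; apply: le_lt_trans (NP a b Na Nb).
    by rewrite raddfB /= lerDl sqr_ge0.
  have [|b bP] := @cauchy_real (fun k => complex.Im (x k u)).
    move=> e e0; have [N NP] := coordC u e e0; exists N => a' b Na Nb.
    apply: lt_sqr => //; apply: le_lt_trans (NP a' b Na Nb).
    have <- : complex.Im (x a' u - x b u) = complex.Im (x a' u) - complex.Im (x b u).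
      by rewrite raddfB.
    by rewrite lerDr sqr_ge0.
  exists (a +i* b) => e e0; have e20 : 0 < e / 2 by rewrite divr_gt0.
  have [N NP] := aP _ e20; have [M MP] := bP _ e20.
  exists (maxn N M) => k; rewrite geq_max => /andP[/NP Nk /MP Mk].
  rewrite normc_def ltcR -(@ltr_pXn2r _ 2) ?nnegrE ?sqrtr_ge0 ?ltW//.
  rewrite sqr_sqrtr ?addr_ge0 ?sqr_ge0//.
  case: (x k u) Nk Mk => f g /=; rewrite !ltr_norml => /andP[? ?] /andP[? ?]; nra.
pose l : T := [ffun u => projT1 (cid (exl u))].
have lP u (e : R) : 0 < e -> exists N, forall k, (N <= k)%N -> `|x k u - l u| < e%:C.
  by rewrite ffunE; exact: (projT2 (cid (exl u)) e).
pose delta u : T := [ffun v => (v == u)%:R].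
exists l => e e0.
have [|N NP] := @hnorm_sum_cvg _ (index_enum _)
  (fun u k => (x k u - l u) *: delta u) _ e e0; last first.
  exists N => k Nk; have := NP k Nk; congr (hnorm _ < e).
  apply/ffunP => v; rewrite sum_ffunE (bigD1 v)//= big1 => [|u uv].
    by rewrite !ffunE eqxx addr0 /GRing.scale /= mulr1.
  by rewrite !ffunE eq_sym (negbTE uv) /GRing.scale /= mulr0.
move=> u f f0; have h0 : 0 < f / (1 + hnorm (delta u)).
  by rewrite divr_gt0// ltr_pwDl ?hnorm_ge0.
have [M MP] := lP u _ h0; exists M => k /MP.
rewrite normc_def ltcR => xkl.
rewrite /hnorm hnorm2Z sqrtrM ?addr_ge0 ?sqr_ge0// -/(hnorm _).
move: xkl; rewrite ltr_pdivlMr ?ltr_pwDl ?hnorm_ge0//; apply: le_lt_trans.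
by rewrite ler_wpM2l ?sqrtr_ge0// lerDr.
Qed.

HB.instance Definition _ := PreHilbert_isComplete.Build R T q_tensor_complete.

End QTensorHilbert.

Definition q_fock (R : realType) (d : nat) (q : R) (hq : -1 < q < 1) : Type :=
  hsum (fun n => q_tensor d hq n).

HB.instance Definition _ (R : realType) (d : nat) (q : R) (hq : -1 < q < 1) :=
  Hilbert.copy (q_fock d hq) (hsum (fun n => q_tensor d hq n)).

Section Operators.
Variable R : realType.

Definition is_adjoint (V : preHilbertType R) (A B : 'B(V)) : Prop :=
  forall x y, dot (A x) y = dot x (B y).

Definition is_selfadjoint (V : preHilbertType R) (A : 'B(V)) : Prop := is_adjoint A A.

Definition vector_state (V : preHilbertType R) (xi : V) (A : 'B(V)) : R[i] :=
  dot (A xi) xi.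

(* [tens] exhibits the Hilbert space [K] as the Hilbert space tensor product of
   [H1] and [H2]; this determines ([K], [tens]) up to a unique unitary. *)
Record is_hilbert_tensor (H1 H2 K : hilbertType R) (tens : H1 -> H2 -> K) : Prop := {
  tens_linearl : forall (a : R[i]) x x' y,
    tens (a *: x + x') y = a *: tens x y + tens x' y;
  tens_linearr : forall (a : R[i]) x y y',
    tens x (a *: y + y') = a *: tens x y + tens x y';
  tens_dot : forall x x' y y', dot (tens x y) (tens x' y') = dot x x' * dot y y';
  tens_dense : forall (z : K) (e : R), 0 < e ->
    exists (m : nat) (x : 'I_m -> H1) (y : 'I_m -> H2),
      hnorm (z - \sum_(j < m) tens (x j) (y j)) < e }.

(* [C] is [A (x) B]; by density and boundedness there is at most one such [C]. *)
Definition is_tensor_operator (H1 H2 K : hilbertType R) (tens : H1 -> H2 -> K)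
    (A : 'B(H1)) (B : 'B(H2)) (C : 'B(K)) : Prop :=
  forall x y, C (tens x y) = tens (A x) (B y).

End Operators.

Section FockVectors.
Variables (R : realType) (d : nat) (q : R) (hq : -1 < q < 1).

Definition homogeneous n (x : q_tensor d hq n) : q_fock d hq :=
  hinj (H := fun n => q_tensor d hq n) x.

Definition vacuum : q_fock d hq := homogeneous ([ffun=> 1] : q_tensor d hq 0).

Definition pure_tensor n (v : n.-tuple 'rV[R[i]]_d) : q_fock d hq :=
  homogeneous (simple_tensor v : q_tensor d hq n).

Definition basis_vector (i : 'I_d) : 'rV[R[i]]_d := delta_mx 0 i.

(* By density of the finite sums of pure tensors there is at most one such bounded
   [L]. *)
Definition is_creation (i : 'I_d) (L : 'B(q_fock d hq)) : Prop :=
  L vacuum = pure_tensor [tuple basis_vector i] /\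
  forall n (v : n.-tuple 'rV[R[i]]_d), (0 < n)%N ->
    L (pure_tensor v) = pure_tensor [tuple of basis_vector i :: v].

Lemma dot_pure_tensor n (v w : n.-tuple 'rV[R[i]]_d) :
  dot (pure_tensor v) (pure_tensor w) =
  \sum_(s : 'S_n) (q ^+ inversions s)%:C * \prod_(i < n) cdot (tnth v i) (tnth w (s i)).
Proof. by rewrite /pure_tensor /homogeneous dot_hinj -q_dot_simple. Qed.

End FockVectors.

(* Main.v *)
(** Put [A i := L i + Ls i]. Applying [(\sum_i Y i) ^+ (2 * n)] to the vacuum tensor and
    expanding over words [w] in the letters [0 .. d-1] gives the sum over [w] of the squares
    of the vacuum moments of [A]. Such a moment is the sum of [q ^+ crossings P] over the
    pair partitions [P] on whose blocks [w] is constant (the q-Wick formula), so that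
    the double sum over [P] and [Q] counts the words constant on the blocks of the join of
    [P] and [Q]: there are [d ^ #|partition_join P Q|] of them.

    For the q-Wick formula, read [w] letter by letter while acting on a basis vector: [L i]
    pushes [i] in front of the vector, and [Ls i] deletes its [k]-th letter, provided it is
    [i], with weight [q ^+ k]. Deleting letter [k] pairs two positions, and this new pair
    crosses exactly the [k] pairs opened later and still to be closed.

    Selfadjointness is checked on simple tensors and extends by density and boundedness. *)
Require Import Defs.
From HB Require Import structures.
From mathcomp Require Import all_boot all_order all_algebra all_fingroup.
Set Implicit Arguments.
Unset Strict Implicit.
Unset Printing Implicit Defensive.
Import Order.TTheory GRing.Theory Num.Theory.
Local Open Scope ring_scope.

(** * Crossings of a family of blocks *)

Section Crossings.
Variable m : nat.
Implicit Types (V W B : {set 'I_m}) (P Q J : {set {set 'I_m}}).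

Lemma crossing_sym V W : crossing V W = crossing W V.
Proof.
apply: eq_existsb => a; apply: eq_existsb => b; apply: eq_existsb => c.
by apply: eq_existsb => e; rewrite orbC (andbC (V == [set a; c])) (andbC (V == [set b; e])).
Qed.

Lemma crossing_irrefl V : crossing V V = false.
Proof.
apply/negbTE/negP; rewrite /crossing; case/existsP=> a; case/existsP=> b; case/existsP=> c.
case/existsP=> e /and4P[ab bc ce VV].
have /eqP/setP/(_ a) : [set a; c] == [set b; e].
  by case/orP: VV => /andP[/eqP {1}<- /eqP <-].
rewrite !inE eqxx /= => /esym/orP[] /eqP ae; first by rewrite ae ltnn in ab.
by move: (ltn_trans ab (ltn_trans bc ce)); rewrite ae ltnn.
Qed.

(** The sets [[set B; W]] are new because [B] is not a block of [P], and distinct [W] give distinct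
    ones, since each [W] differs from [B]. *)
Lemma crossings_setU1 B P : B \notin P ->
  crossings (B |: P) = (#|[set W in P | crossing B W]| + crossings P)%N.
Proof.
move=> BP; have neB W : W \in P -> W != B by apply: contraTneq => ->.
rewrite /crossings.
have -> : [set [set V; W] | V in B |: P, W in B |: P & crossing V W] =
  [set [set B; W] | W in [set W in P | crossing B W]] :|:
  [set [set V; W] | V in P, W in P & crossing V W].
  apply/setP => Z; rewrite in_setU; apply/imset2P/orP.
    move=> [V W VP]; rewrite inE => /andP[WP cVW] ->.
    move: VP WP; rewrite !in_setU1 => /predU1P[VB|VP] /predU1P[WB|WP].
    - by rewrite VB WB crossing_irrefl in cVW.
    - by left; apply/imsetP; exists W; rewrite ?VB // inE WP -VB.
    - left; apply/imsetP; exists V; rewrite ?WB 1?setUC //.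
      by rewrite inE VP -WB crossing_sym.
    - by right; apply/imset2P; exists V W; rewrite // inE WP.
  case=> [/imsetP[W]|/imset2P[V W VP]]; rewrite inE => /andP[WP cW] ->.
    by exists B W; rewrite ?inE ?eqxx ?WP ?orbT.
  by exists V W; rewrite ?inE ?VP ?WP ?orbT.
rewrite cardsU (_ : _ :&: _ = set0) ?cards0 ?subn0.
  congr (_ + _)%N; apply: card_in_imset => W W'; rewrite !inE => /andP[WP _] /andP[W'P _].
  move=> /setP/(_ W); rewrite !inE eqxx orbT (negbTE (neB _ WP)) /=.
  by move=> /esym/eqP.
apply/setP => Z; rewrite in_setI in_set0; apply/negP => /andP[/imsetP[W _ ->]].
case/imset2P => V W' VP; rewrite inE => /andP[W'P _] /setP/(_ B).
by rewrite !inE eqxx !(eq_sym B) (negbTE (neB _ VP)) (negbTE (neB _ W'P)).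
Qed.

Lemma crossings0 : crossings (set0 : {set {set 'I_m}}) = 0%N.
Proof.
apply/eqP; rewrite cards_eq0; apply/set0Pn => -[Z /imset2P[V W]].
by rewrite in_set0.
Qed.

(** No block crosses itself, so each crossing is a two-element subset of [P]. *)
Lemma crossings_le P : (crossings P <= 'C(#|P|, 2))%N.
Proof.
rewrite -cards_draws; apply/subset_leq_card/subsetP => Z /imset2P[V W VP].
rewrite inE => /andP[WP cVW] ->; rewrite inE subUset !sub1set VP WP /=.
by rewrite cards2 (contraTneq _ cVW) // => ->; rewrite crossing_irrefl.
Qed.

End Crossings.

(** * The q-Wick recursion and matchings of positions *)

Section Wick.
Variables (A : comNzRingType) (q : A).

Definition del (T : Type) (k : nat) (u : seq T) : seq T := take k u ++ drop k.+1 u.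

Lemma map_del (T T' : Type) (f : T -> T') k u : map f (del k u) = del k (map f u).
Proof. by rewrite /del map_cat map_take map_drop. Qed.

Lemma size_del (T : Type) k (u : seq T) : (k < size u)%N -> size (del k u) = (size u).-1.
Proof.
by move=> ku; rewrite size_cat size_take size_drop ku; case: (size u) ku => // n kn;
  rewrite subSS subnKC.
Qed.

(* [u] is the stack of letters read so far that are still waiting for a partner, the
   most recent one first. Closing the [k]-th of them crosses the [k] younger ones. *)
Fixpoint wick (T : eqType) (w u : seq T) : A :=
  if w is i :: w' then
    wick w' (i :: u) +
    \sum_(k < size u) q ^+ k * (nth i u k == i)%:R * wick w' (del k u)
  else (u == [::])%:R.

Definition constant_on (T : eqType) (I : finType) (P : {set {set I}}) (c : I -> T) :=
  [forall V in P, forall x in V, forall y in V, c x == c y].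

Variable m : nat.
Implicit Types (u s : seq 'I_m) (B V : {set 'I_m}) (P : {set {set 'I_m}}).

(** [u] lists the positions read and still unpaired, [s] those not yet read. Two positions of the
    stack never form a block: a pair is closed only by a position read later. *)
Definition matching u s P : bool :=
  partition P ([set x in u] :|: [set x in s]) &&
  [forall V in P, (#|V| == 2%N) && ~~ (V \subset [set x in u])].

(** Left open, [j] joins the stack and must be paired later; what this excludes is exactly a block
    made of [j] and an older open position. *)
Lemma matching_open u j s P :
  matching (j :: u) s P =
  matching u (j :: s) P && ~~ [exists x in u, [set x; j] \in P].
Proof.
rewrite /matching (_ : [set x in j :: u] :|: [set x in s] =
  [set x in u] :|: [set x in j :: s]); last first.
  by apply/setP => x; rewrite !inE orbCA orbA.
rewrite -andbA; congr (_ && _); apply/forall_inP/andP.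
  move=> H; split.
    apply/forall_inP => V /H /andP[-> VU]; apply: contra VU => /subset_trans; apply.
    by apply/subsetP => x; rewrite !inE => ->; rewrite orbT.
  apply/negP => /exists_inP[x xu /H /andP[_ /negP]]; apply.
  by rewrite subUset !sub1set !inE xu eqxx orbT.
move=> [/forall_inP H noex] V VP; have /andP[V2 VU] := H V VP; rewrite V2 /=.
apply: contra noex => Vju; have jV : j \in V.
  apply: contraNT VU => jV; apply/subsetP => x xV; move: (subsetP Vju x xV).
  by rewrite !inE => /predU1P[xj|//]; rewrite -xj xV in jV.
have /cards1P[x Vx] : #|V :\ j| == 1%N by move: V2; rewrite (cardsD1 j V) jV.
have /setD1P[xj xV] : x \in V :\ j by rewrite Vx set11.
apply/exists_inP; exists x; first by move: (subsetP Vju x xV); rewrite !inE (negbTE xj).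
by rewrite setUC -Vx setD1K.
Qed.

Lemma mem_del u k x : uniq u -> (k < size u)%N ->
  (x \in del k u) = (x \in u) && (x != nth x u k).
Proof.
move=> Uu ku; have def_u := cat_take_drop k u; rewrite (drop_nth x ku) in def_u.
move: Uu; rewrite -{1 3}def_u /del cat_uniq /= negb_or => /and3P[_ /andP[y1 _] /andP[y2 _]].
rewrite !mem_cat in_cons; have [xy|//] := eqVneq x (nth x u k); last by rewrite andbT.
by rewrite /= andbF {1 2}xy (negbTE y1) (negbTE y2).
Qed.

(** The invariant of the recursion is [increasing (rev u ++ s)]: positions are read in order, and
    the stack, most recent first, lies before everything unread. *)
Definition increasing s : bool := pairwise (fun a b : 'I_m => (a < b)%N) s.

Lemma set2_ltn_inj (a b c e : 'I_m) : (a < b)%N -> (c < e)%N ->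
  [set a; b] = [set c; e] -> a = c /\ b = e.
Proof.
move=> ab ce E; move: (set21 a b) (set22 a b) ab; rewrite E !inE.
case/orP => /eqP->; case/orP => /eqP->; rewrite ?ltnn //.
by rewrite ltnNge ltnW.
Qed.

Lemma increasing_uniq s : increasing s -> uniq s.
Proof. by apply: pairwise_uniq => a; rewrite ltnn. Qed.

Lemma constant_on_setU1 (T : eqType) (c : 'I_m -> T) x j P :
  constant_on ([set x; j] |: P) c = (c x == c j) && constant_on P c.
Proof.
apply/forall_inP/andP => [H|[/eqP cB /forall_inP H] V /setU1P[->|]]; last exact: H.
  split; last by apply/forall_inP => V VP; apply: H; rewrite setU1r.
  have /forall_inP/(_ x (set21 _ _))/forall_inP := H _ (setU11 _ _).
  by apply; rewrite set22.
apply/forall_inP => y /set2P[] ->; apply/forall_inP => z /set2P[] ->;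
  by rewrite ?cB.
Qed.

(** * Closing the pair formed by the next position and an open one *)

Section Close.
Variables (u s : seq 'I_m) (j : 'I_m) (k : nat).
Hypothesis ku : (k < size u)%N.
Hypothesis us : increasing (rev u ++ j :: s).
Let x := nth j u k.
Let B := [set x; j].

Lemma stack_uniq : uniq u.
Proof. by move/increasing_uniq: us; rewrite cat_uniq rev_uniq => /andP[]. Qed.

Lemma stack_lt y : y \in u -> (y < j)%N.
Proof.
move=> yu; move: us; rewrite /increasing pairwise_cat => /andP[/allrelP H _].
by apply: H; rewrite ?mem_rev ?inE ?eqxx.
Qed.

Lemma suffix_gt y : y \in s -> (j < y)%N.
Proof.
move=> ys; move: us; rewrite /increasing pairwise_cat => /and3P[_ _ /andP[/allP H _]].
exact: H.
Qed.

Let mem_x : x \in u. Proof. exact: mem_nth. Qed.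

(** The stack decreases from its head, so what precedes index [k] is what was opened after [x]. *)
Lemma mem_take_gt y : y \in u -> (y \in take k u) = (x < y)%N.
Proof.
have def_u := cat_take_drop k u; rewrite (drop_nth j ku) -/x in def_u.
move: us; rewrite -{1 2}def_u /increasing rev_cat rev_cons !pairwise_cat.
rewrite -cats1 pairwise_cat => /and3P[_ /and3P[/allrelP H1 /and3P[/allrelP H2 _ _] _] _].
rewrite mem_cat in_cons; have [yt _|_] := boolP (y \in take k u).
  by apply/esym/H1; rewrite ?mem_rev // mem_cat inE eqxx orbT.
case/predU1P=> [->|yd]; first by rewrite ltnn.
by apply/esym/negbTE; rewrite -leqNgt ltnW //; apply: H2; rewrite ?mem_rev ?inE.
Qed.

Lemma increasing_open : increasing (rev (j :: u) ++ s).
Proof. by rewrite rev_cons cat_rcons. Qed.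

Lemma increasing_close : increasing (rev (del k u) ++ s).
Proof.
apply: subseq_pairwise us; apply: cat_subseq; last exact: subseq_cons.
rewrite subseq_rev -{2}(cat_take_drop k u); apply: cat_subseq => //.
by rewrite (drop_nth j ku) subseq_cons.
Qed.

(** [pblock P] maps the [k] open positions younger than [x] bijectively onto the blocks crossing
    [B]: such a position lies between [x] and [j], and its partner, which cannot be open, lies
    beyond [j]. *)
Lemma crossings_close P : matching (del k u) s P ->
  crossings (B |: P) = (k + crossings P)%N.
Proof.
case/andP=> partP /forall_inP H; have [/eqP covP tP _] := and3P partP.
have in_D V y : V \in P -> y \in V -> (y \in u) && (y != x) || (y \in s).
  move=> VP yV; have := subsetP (partitionS partP VP) y yV.
  by rewrite !inE mem_del ?stack_uniq // (set_nth_default j).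
rewrite crossings_setU1; last first.
  apply/negP => BP; have := in_D _ x BP (set21 _ _); rewrite eqxx andbF /=.
  by move/suffix_gt; rewrite ltnNge ltnW // stack_lt // mem_x.
congr (_ + _)%N; transitivity #|[set y in take k u]|; last first.
  have /card_uniqP : uniq (take k u) by rewrite take_uniq // stack_uniq.
  by rewrite size_takel 1?ltnW // cardsE.
have takeP y : y \in take k u -> [/\ y \in u, (x < y)%N, y \in del k u & y \in cover P].
  move=> yt; have yu := mem_take yt; have xy : (x < y)%N by rewrite -mem_take_gt.
  have yd : y \in del k u by rewrite mem_cat yt.
  by split=> //; rewrite covP !inE yd.
(* Injectivity: two open positions in one block would fill it, and the block would lie in the
   stack. *)
rewrite -(card_in_imset (f := pblock P)); last first.
  move=> y y'; rewrite !inE => yt y't E; apply: contraTeq isT => yy'.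
  have [_ _ yd yc] := takeP y yt; have [_ _ y'd y'c] := takeP y' y't.
  have /andP[/eqP V2 /negP[]] := H _ (pblock_mem yc).
  have sub : [set y; y'] \subset pblock P y.
    by rewrite subUset !sub1set mem_pblock yc E mem_pblock.
  have /eqP <- : [set y; y'] == pblock P y by rewrite eqEcard sub V2 cards2 yy'.
  by rewrite subUset !sub1set !inE yd.
apply: eq_card => W; rewrite inE; apply/andP/imsetP.
  move=> [WP]; rewrite /crossing; case/existsP=> a; case/existsP=> b; case/existsP=> c.
  case/existsP=> e /and4P[ab bc ce /orP[]] /andP[/eqP EB /eqP EW].
    (* Here [x < b < j < e]: as [b] comes before [j], it is open, and younger than [x]. *)
    have [xa jc] := set2_ltn_inj (stack_lt mem_x) (ltn_trans ab bc) EB; subst a c.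
    have bW : b \in W by rewrite EW set21.
    have /orP[/andP[bu bx]|/suffix_gt] := in_D W b WP bW; last first.
      by rewrite ltnNge ltnW.
    exists b; first by rewrite inE mem_take_gt.
    by rewrite (def_pblock tP WP) // EW set21.
  (* Here [a < x < c < j]: both elements of [W] would be open, which a matching forbids. *)
  have [xb je] := set2_ltn_inj (stack_lt mem_x) (ltn_trans bc ce) EB; subst b e.
  have aW : a \in W by rewrite EW set21.
  have cW : c \in W by rewrite EW set22.
  have /orP[|/suffix_gt] := in_D W a WP aW; last first.
    by rewrite ltnNge ltnW // (ltn_trans ab) // (ltn_trans bc).
  have /orP[|/suffix_gt] := in_D W c WP cW; last by rewrite ltnNge ltnW.
  have /andP[_ /negP Wd] := H W WP => cd ad; case: Wd.
  by rewrite EW subUset !sub1set !inE !mem_del ?stack_uniq // !(set_nth_default j) // cd ad.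
move=> [y]; rewrite inE => yt ->; have [yu xy yd yc] := takeP y yt.
have VP := pblock_mem yc; split=> //; set V := pblock P y in VP *.
have yV : y \in V by rewrite mem_pblock.
have /andP[V2 Vd] := H V VP.
have /cards1P[z Vz] : #|V :\ y| == 1%N by move: V2; rewrite (cardsD1 y V) yV.
have EV : V = [set y; z] by rewrite -Vz setD1K.
have zV : z \in V by rewrite EV set22.
have /orP[zd|zs] := in_D V z VP zV.
  case/negP: Vd; rewrite EV subUset !sub1set !inE yd mem_del ?stack_uniq //.
  by rewrite (set_nth_default j).
rewrite /crossing; apply/existsP; exists x; apply/existsP; exists y.
apply/existsP; exists j; apply/existsP; exists z.
by rewrite xy stack_lt // suffix_gt // EV !eqxx.
Qed.

(** The conjunct [(B |: P) :\ B == P] says that [B] is not in [P]; it is the side condition that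
    [reindex_onto] produces in [wick_matchings]. *)
Lemma matching_close P :
  matching u (j :: s) (B |: P) && ((B |: P) :\ B == P) = matching (del k u) s P.
Proof.
have xu := mem_x; have xj : x != j by apply: contraTneq (stack_lt xu) => ->; rewrite ltnn.
have ju : j \notin u by apply/negP => /stack_lt; rewrite ltnn.
have js : j \notin s by apply/negP => /suffix_gt; rewrite ltnn.
have xs : x \notin s by apply/negP => /suffix_gt; rewrite ltnNge ltnW ?stack_lt.
have delE y : (y \in del k u) = (y \in u) && (y != x).
  by rewrite mem_del ?stack_uniq // (set_nth_default j).
have defD : ([set y in u] :|: [set y in j :: s]) :\: B = [set y in del k u] :|: [set y in s].
  apply/setP => y; rewrite !inE delE.
  have [->|yx] := eqVneq y x; first by rewrite (negbTE xs) andbF.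
  have [->|yj] := eqVneq y j; first by rewrite (negbTE ju) (negbTE js).
  by rewrite andbT.
apply/andP/idP.
  case=> [/andP[partP /forall_inP H] /eqP PB]; apply/andP; split.
    by rewrite -defD -{1}PB partitionD1 ?setU11.
  apply/forall_inP => V VP; have /andP[-> VU] := H V (setU1r _ VP).
  apply: contra VU => /subset_trans; apply; apply/subsetP => y.
  by rewrite !inE delE => /andP[].
case/andP=> partP /forall_inP H.
have VD V : V \in P -> V \subset [set y in del k u] :|: [set y in s] by apply: partitionS.
have BP : B \notin P.
  by apply/negP => /VD; rewrite subUset sub1set !inE delE eqxx andbF (negbTE xs).
split; last by rewrite setU1K.
apply/andP; split.
  have -> : [set y in u] :|: [set y in j :: s] = B :|: ([set y in del k u] :|: [set y in s]).
    rewrite -defD setDE setUIr setUCr setIT; apply/esym/setUidPr.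
    by rewrite subUset !sub1set !inE xu eqxx orbT.
  apply: partitionU1 => //; first by apply/set0Pn; exists x; rewrite set21.
  by rewrite -defD -setI_eq0 setDE setICA setICr setI0.
apply/forall_inP => V /setU1P[->|VP].
  by rewrite cards2 xj /= subUset !sub1set !inE (negbTE ju) andbF.
have /andP[-> Vd] := H V VP; apply: contra Vd => VU; apply/subsetP => y yV.
rewrite inE delE; move: (subsetP VU y yV); rewrite inE => -> /=.
apply: contraTneq yV => ->; apply/negP => xV.
by move: (subsetP (VD V VP) x xV); rewrite !inE delE eqxx andbF (negbTE xs).
Qed.

End Close.

(** Induction on the unread positions. The next position [j] either stays open, which gives the
    first term of [wick], or closes a pair with the open position of index [k], which gives the term
    of index [k] in the sum. *)
Lemma wick_matchings (T : eqType) (c : 'I_m -> T) s u : increasing (rev u ++ s) ->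
  wick (map c s) (map c u) =
  \sum_(P | matching u s P && constant_on P c) q ^+ crossings P.
Proof.
elim: s u => [|j s IHs] u us.
  case: u us => [|x u] _ /=.
    rewrite (big_pred1 set0) ?crossings0 // => P.
    rewrite /matching (_ : _ :|: _ = set0) ?partition_set0; last first.
      by apply/setP => y; rewrite !inE.
    have [->|/negbTE/esym//] := eqVneq P set0; rewrite /constant_on /=.
    by rewrite eqxx; apply: (introT andP); split; apply/forall_inP => V; rewrite in_set0.
  (* Nothing is left to read but the stack is not empty: the block of [x] would lie in the stack. *)
  rewrite big_pred0 // => P; apply: contraTF isT => /andP[/andP[partP /forall_inP H] _].
  have [/eqP covP _ _] := and3P partP.
  have /pblock_mem VP : x \in cover P by rewrite covP !inE eqxx.
  have /andP[_ /negP[]] := H _ VP; apply: subset_trans (partitionS partP VP) _.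
  by apply/subsetP => y; rewrite !inE orbF.
rewrite /= -map_cons IHs ?(increasing_open us) // size_map.
rewrite [RHS](bigID (fun P => [exists x in u, [set x; j] \in P])) /= addrC; congr (_ + _).
  by apply: eq_bigl => P; rewrite matching_open andbAC.
(* Blocks being disjoint and the stack duplicate-free, exactly one [k] gives the block of [j]. *)
transitivity (\sum_(k < size u) \sum_(P | (matching u (j :: s) P && constant_on P c) &&
    ([set nth j u k; j] \in P)) q ^+ crossings P); last first.
  rewrite (exchange_big_dep (fun P => (matching u (j :: s) P && constant_on P c) &&
    [exists x in u, [set x; j] \in P])) /=; last first.
    move=> k P _ /andP[-> xP] /=; apply/exists_inP; exists (nth j u k) => //.
    exact: mem_nth.
  apply: eq_bigr => P /andP[MP /exists_inP[x xu xP]].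
  have ku : (index x u < size u)%N by rewrite index_mem.
  rewrite (big_pred1 (Ordinal ku)) // => k; rewrite MP /=; apply/idP/eqP => [kP|->].
    apply: val_inj => /=; have tP : trivIset P by case/andP: MP => /andP[/and3P[]].
    have E : [set nth j u k; j] = [set x; j].
      by rewrite -(def_pblock tP kP (set22 _ _)) -(def_pblock tP xP (set22 _ _)).
    have kj : nth j u k != j.
      by apply: contraTneq (stack_lt us (mem_nth j (ltn_ord k))) => ->; rewrite ltnn.
    move: (set21 (nth j u k) j); rewrite E !inE (negbTE kj) orbF => /eqP <-.
    by rewrite index_uniq ?(stack_uniq us).
  by rewrite nth_index.
apply: eq_bigr => k _; set x := nth j u k; set B := [set x; j].
rewrite (nth_map j) // -/x -map_del IHs ?(increasing_close _ us) //.
(* Removing [B] is inverse to adding it, and turns the matchings in which [j] closes [x] into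
   matchings of the remaining positions. *)
rewrite [RHS](reindex_onto (fun P => B |: P) (fun P => P :\ B)) /=; last first.
  by move=> P /andP[_ BP]; rewrite setD1K.
under [RHS]eq_bigl => P do rewrite setU11 andbT constant_on_setU1 andbAC
  (matching_close _ us) // -/x andbCA.
have [cx|_] := eqVneq (c x) (c j); last by rewrite mulr0 mul0r big_pred0.
rewrite mulr1 mulr_sumr; apply: eq_bigr => P /= /andP[MP _].
by rewrite (crossings_close _ us MP) // exprD.
Qed.

End Wick.

(** * Words constant on the blocks of a partition *)

Section Counting.
Variable m : nat.
Implicit Types (V W : {set 'I_m}) (P Q J : {set {set 'I_m}}).

Lemma constant_onP (T : eqType) P (c : 'I_m -> T) :
  reflect (forall V x y, V \in P -> x \in V -> y \in V -> c x = c y) (constant_on P c).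
Proof.
apply: (iffP forall_inP) => [H V x y VP xV yV|H V VP].
  by have /forall_inP/(_ x xV)/forall_inP/(_ y yV)/eqP := H V VP.
by apply/forall_inP => x xV; apply/forall_inP => y yV; apply/eqP/(H V).
Qed.

Lemma refines_constant_on (T : eqType) P J (c : 'I_m -> T) :
  refines P J -> constant_on J c -> constant_on P c.
Proof.
move=> /forall_inP PJ /constant_onP cJ; apply/constant_onP => V x y /PJ.
by case/exists_inP => W WJ /subsetP VW /VW xW /VW yW; apply: cJ WJ xW yW.
Qed.

Lemma refines_preim_partition (T : eqType) P (c : 'I_m -> T) :
  partition P [set: 'I_m] -> constant_on P c ->
  refines P (preim_partition c [set: 'I_m]).
Proof.
move=> partP /constant_onP cP; apply/forall_inP => V VP.
have /set0Pn[x xV] := partition_neq0 partP VP.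
apply/exists_inP; exists [set y in [set: 'I_m] | c x == c y].
  by apply/imsetP; exists x.
by apply/subsetP => y yV; rewrite !inE /= (cP V x y) ?eqxx.
Qed.

Lemma constant_on_preim_partition (T : eqType) (c : 'I_m -> T) :
  constant_on (preim_partition c [set: 'I_m]) c.
Proof.
apply/constant_onP => V x y /imsetP[z _ ->].
by rewrite !inE => /eqP <- /eqP.
Qed.

(** If a word is constant on the blocks of both, then both refine the partition into its fibres, and
    so does the join. *)
Lemma constant_on_join (T : eqType) P Q (c : 'I_m -> T) :
  partition P [set: 'I_m] -> partition Q [set: 'I_m] ->
  constant_on (partition_join P Q) c = constant_on P c && constant_on Q c.
Proof.
move=> partP partQ.
have /and4P[partJ PJ QJ /forallP Jmin] := partition_joinP partP partQ.
apply/idP/idP => [cJ|/andP[cP cQ]].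
  by rewrite (refines_constant_on PJ cJ) (refines_constant_on QJ cJ).
apply: refines_constant_on (constant_on_preim_partition c).
apply: (implyP (Jmin _)); rewrite preim_partitionP /=.
by apply/andP; split; apply: refines_preim_partition.
Qed.

(** Such a word is a free choice of one letter per block. Choices are encoded as functions with the
    fixed value [y0] outside [J], so that a word determines its function. *)
Lemma card_constant_on d J : (0 < d)%N -> partition J [set: 'I_m] ->
  #|[set w : m.-tuple 'I_d | constant_on J (tnth w)]| = (d ^ #|J|)%N.
Proof.
move=> d0 partJ; have [/eqP covJ tJ _] := and3P partJ; pose y0 := Ordinal d0.
have pbJ x : pblock J x \in J by rewrite pblock_mem // covJ.
have mem_pb x : x \in pblock J x by rewrite mem_pblock covJ.
pose f (g : {ffun {set 'I_m} -> 'I_d}) := [tuple g (pblock J i) | i < m].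
have -> : [set w : m.-tuple 'I_d | constant_on J (tnth w)] =
    f @: [set g in pffun_on y0 (mem J) predT].
  apply/setP => w; rewrite inE; apply/constant_onP/imsetP => [cw|[g _ -> V x y VJ xV yV]].
    exists [ffun V : {set 'I_m} => if V \in J then
        if [pick x in V] is Some x then tnth w x else y0 else y0].
      rewrite inE; apply/pffun_onP; split=> //; apply/subsetP => V.
      by rewrite inE ffunE; case: ifP => //; rewrite eqxx.
    apply: eq_from_tnth => i; rewrite tnth_mktuple ffunE pbJ.
    by case: pickP => [x xi|/(_ i)]; [apply: cw (pbJ i) _ _ | rewrite mem_pb].
  by rewrite !tnth_mktuple (def_pblock tJ VJ xV) (def_pblock tJ VJ yV).
rewrite card_in_imset; first by rewrite cardsE card_pffun_on card_ord.
move=> g g'; rewrite !inE => /pffun_onP[/supportP sg _] /pffun_onP[/supportP sg' _] E.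
apply/ffunP => V; have [VJ|VJ] := boolP (V \in J); last by rewrite sg ?sg'.
have /set0Pn[x xV] := partition_neq0 partJ VJ.
by have := congr1 (fun w => tnth w x) E; rewrite !tnth_mktuple (def_pblock tJ VJ xV).
Qed.

(** Each block of [J] contains a block of [P], so sending a block of [P] to the block of [J] around
    it is onto [J]. *)
Lemma leq_card_refines P J : partition P [set: 'I_m] -> partition J [set: 'I_m] ->
  refines P J -> (#|J| <= #|P|)%N.
Proof.
move=> partP partJ /forall_inP PJ; have [/eqP covP tP _] := and3P partP.
have [_ tJ _] := and3P partJ.
pose f V := if [pick W in J | V \subset W] is Some W then W else V.
suff JP : J \subset f @: P by apply: leq_trans (subset_leq_card JP) (leq_imset_card _ _).
apply/subsetP => W WJ; have /set0Pn[x xW] := partition_neq0 partJ WJ.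
have xP : pblock P x \in P by rewrite pblock_mem // covP.
apply/imsetP; exists (pblock P x) => //; rewrite /f; case: pickP => [W'|noW].
  case/andP=> W'J /subsetP sub; rewrite -(def_pblock tJ WJ xW); apply: def_pblock => //.
  by apply: sub; rewrite mem_pblock covP.
by have /exists_inP[W' W'J sub] := PJ _ xP; have := noW W'; rewrite W'J sub.
Qed.

End Counting.

(** * Pair partitions and the meander polynomial *)

Section PairPartitions.
Variable n : nat.
Implicit Types P Q : {set {set 'I_(2 * n)}}.

Lemma pair_partition_partition P : P \in pair_partitions n -> partition P [set: 'I_(2 * n)].
Proof. by rewrite inE => /andP[]. Qed.

Lemma card_pair_partition P : P \in pair_partitions n -> #|P| = n.
Proof.
rewrite inE => /andP[partP /forall_inP H].
have := card_uniform_partition (fun V VP => eqP (H V VP)) partP.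
by rewrite cardsT card_ord [RHS]mulnC => /eqP; rewrite eqn_pmul2l // => /eqP.
Qed.

(** This bound, like the next one on crossings, keeps every pair [(P, Q)] within the summation
    ranges of [meander_poly]. *)
Lemma card_join P Q : (0 < n)%N -> P \in pair_partitions n -> Q \in pair_partitions n ->
  (0 < #|partition_join P Q| <= n)%N.
Proof.
move=> n0 PP QP; have partP := pair_partition_partition PP.
have /and4P[partJ PJ _ _] := partition_joinP partP (pair_partition_partition QP).
apply/andP; split; last first.
  by rewrite -[leqRHS](card_pair_partition PP) leq_card_refines.
rewrite card_gt0.
have i0 : 'I_(2 * n) by exists 0%N; rewrite muln_gt0.
apply: contraTneq partJ => ->; rewrite /partition /cover big_set0 eq_sym.
by apply/nandP; left; apply/set0Pn; exists i0.
Qed.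

Lemma crossings_pair_partition P Q : P \in pair_partitions n -> Q \in pair_partitions n ->
  (crossings P + crossings Q <= n ^ 2 - n)%N.
Proof.
move=> PP QP; have := crossings_le P; have := crossings_le Q.
rewrite !card_pair_partition // => cQ cP; apply: leq_trans (leq_add cP cQ) _.
(* [n ^ 2 - n] is twice ['C(n, 2)], the number of pairs of blocks in one pair partition. *)
have -> : (n ^ 2 - n = n * n.-1)%N by rewrite -mulnn -subn1 mulnBr muln1.
by rewrite addnn bin2 -[leqRHS]odd_double_half leq_addl.
Qed.

Lemma meander_polyE (A : comNzRingType) (t u : A) : (0 < n)%N ->
  meander_poly n t u = \sum_(P in pair_partitions n) \sum_(Q in pair_partitions n)
    t ^+ #|partition_join P Q| * u ^+ (crossings P + crossings Q).
Proof.
move=> n0; rewrite pair_big_dep /= /meander_poly.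
pose K (PQ : {set {set 'I_(2 * n)}} * {set {set 'I_(2 * n)}}) := #|partition_join PQ.1 PQ.2|.
pose L (PQ : {set {set 'I_(2 * n)}} * {set {set 'I_(2 * n)}}) :=
  (crossings PQ.1 + crossings PQ.2)%N.
transitivity (\sum_(1 <= k < n.+1) \sum_(0 <= l < (n ^ 2 - n).+1)
   \sum_(PQ | [&& (PQ.1 \in pair_partitions n) && (PQ.2 \in pair_partitions n),
                 K PQ == k & L PQ == l]) t ^+ K PQ * u ^+ L PQ).
  apply: eq_bigr => k _; apply: eq_bigr => l _.
  rewrite (eq_bigr (fun=> t ^+ k * u ^+ l)); last by move=> PQ /and3P[_ /eqP -> /eqP ->].
  rewrite sumr_const -[RHS]mulr_natl mulrA; congr (_%:R * _ * _).
  rewrite /meander_count; apply: eq_card => PQ. by rewrite in_set [RHS]unfold_in -andbA.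
under [LHS]eq_bigr => k _.
  under eq_bigr => l _ do rewrite big_mkcond.
  rewrite exchange_big /=.
  over.
rewrite exchange_big /= [RHS]big_mkcond; apply: eq_bigr => PQ _ /=.
have [/andP[PP QP]|_] := boolP (_ && _); last by rewrite big1 // => k _; rewrite big1.
have /andP[K0 Kn] := card_join n0 PP QP.
(* A fixed pair contributes only at [k = K PQ] and [l = L PQ]. *)
rewrite (bigD1_seq (K PQ)) ?iota_uniq ?mem_index_iota ?K0 //= [X in _ + X]big1; last first.
  by move=> k /negbTE kK; rewrite big1 // => l _; rewrite eq_sym kK.
rewrite addr0 (bigD1_seq (L PQ)) ?iota_uniq ?mem_index_iota ?ltnS ?crossings_pair_partition //=.
by rewrite !eqxx big1 ?addr0 // => l /negbTE lL; rewrite eq_sym lL.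
Qed.

(** For an empty stack, the condition on it only says that blocks are nonempty, so the matchings of
    all positions are the pair partitions. *)
Lemma wick_pair_partitions (A : comNzRingType) (q : A) (T : eqType) (w : (2 * n).-tuple T) :
  wick q w [::] =
  \sum_(P in pair_partitions n | constant_on P (tnth w)) q ^+ crossings P.
Proof.
rewrite -{1}(map_tnth_enum w) -[X in wick q _ X]/(map (tnth w) [::]) wick_matchings.
  apply: eq_bigl => P; congr (_ && _); rewrite inE /matching.
  have -> : [set x in [::]] :|: [set x in enum 'I_(2 * n)] = [set: 'I_(2 * n)].
    by apply/setP => x; rewrite !inE mem_enum.
  apply: andb_id2l => partP; apply: eq_forallb_in => V VP.
  by rewrite (_ : [set x in [::]] = set0) ?subset0 ?(partition_neq0 partP VP) ?andbT //;
    apply/setP => x; rewrite !inE.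
rewrite /increasing /= -(pairwise_map val ltn) val_enum_ord.
by rewrite -(sorted_pairwise ltn_trans) iota_ltn_sorted.
Qed.

(** Once both factors are expanded and the sums exchanged, each pair [(P, Q)] is weighted by the
    number of words constant on the blocks of both, that is, on those of their join. *)
Lemma sum_wick_sqr (A : comNzRingType) (q : A) d : (0 < n)%N -> (0 < d)%N ->
  \sum_(w : (2 * n).-tuple 'I_d) wick q w [::] * wick q w [::] = meander_poly n d%:R q.
Proof.
move=> n0 d0; rewrite meander_polyE //.
under eq_bigr => w _ do rewrite wick_pair_partitions big_mkcondr big_distrlr /=.
rewrite exchange_big /=; apply: eq_bigr => P PP.
rewrite exchange_big /=; apply: eq_bigr => Q QP.
have partP := pair_partition_partition PP; have partQ := pair_partition_partition QP.
have /and4P[partJ _ _ _] := partition_joinP partP partQ.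
rewrite -natrX -(card_constant_on d0 partJ) -sum1_card natr_sum mulr_suml.
rewrite [RHS]big_mkcond /=; apply: eq_bigr => w _.
rewrite inE constant_on_join // mul1r exprD.
by do 2![case: (constant_on _ _)]; rewrite ?mul0r ?mulr0.
Qed.

End PairPartitions.

From mathcomp Require Import all_classical all_reals all_analysis.
From mathcomp Require Import complex ring lra.
Local Open Scope complex_scope.

(** * Expansion of the q-inner product along the first letter *)

Section WordDot.
Variables (R : realType) (d : nat) (q : R).

(** Permutations are sorted by the image [k] of the first index; the resulting map is injective
    between sets of the same size [(n + 1)!]. *)
Lemma big_lift_perm (A : nmodType) n (F : 'S_n.+1 -> A) :
  \sum_s F s = \sum_(k < n.+1) \sum_(s : 'S_n) F (lift_perm ord0 k s).
Proof.
rewrite pair_big /=; apply: reindex; apply: onW_bij.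
apply: inj_card_bij; last by rewrite card_prod !card_Sn card_ord factS.
move=> [k s] [k' s'] /= E.
have kk' : k = k' by rewrite -[k](lift_perm_id ord0 k s) E lift_perm_id.
rewrite -{}kk' in E *; congr (_, _); apply/permP => i; apply: (@lift_inj _ k).
by rewrite -!(lift_perm_lift ord0) E.
Qed.

Lemma inversions_sum n (s : 'S_n) :
  inversions s = (\sum_(i < n) \sum_(j < n) ((i < j) && (s j < s i)))%N.
Proof.
rewrite /inversions -sum1_card pair_big /= big_mkcond /=.
by apply: eq_bigr => -[i j] _; rewrite inE /=; case: (_ && _).
Qed.

(** The first index, sent to [k], is inverted with the [k] indices of smaller image; lifting
    preserves order, so the other inversions are those of [s]. *)
Lemma inversions_lift n (k : 'I_n.+1) (s : 'S_n) :
  inversions (lift_perm ord0 k s) = (k + inversions s)%N.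
Proof.
have bump_lt h a b : (bump h a < bump h b)%N = (a < b)%N by rewrite ltnNge leq_bump2 -ltnNge.
rewrite !inversions_sum big_ord_recl /= lift_perm_id; congr (_ + _)%N.
  (* Summing over the images [j] under [s] instead of the indices, the terms are 1 exactly for
     [j < k]. *)
  rewrite big_ord_recl /= add0n (reindex_inj (@perm_inj _ s^-1%g)) /=.
  rewrite -[RHS]muln1 -[in RHS](card_ord k) -sum_nat_const.
  rewrite (big_ord_widen n (fun=> 1%N)) ?leq_ord // [RHS]big_mkcond /=.
  apply: eq_bigr => j _; rewrite lift_perm_lift permKV /= /bump.
  have [kj|jk] := leqP k j; last by rewrite add0n jk.
  by rewrite ltnNge (leq_trans kj (leq_addl _ _)).
apply: eq_bigr => i _; rewrite big_ord_recl /= add0n; apply: eq_bigr => j _.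
by rewrite !lift_perm_lift /= !bump_lt.
Qed.

(** [word_dot] is a q-permanent; this is its Laplace expansion along the first row. *)
Lemma word_dot_cons n i (v : n.-tuple 'I_d) (u : n.+1.-tuple 'I_d) :
  word_dot q [tuple of i :: v] u =
  \sum_(k < n.+1) q ^+ k * (tnth u k == i)%:R *
    word_dot q v [tuple tnth u (lift k j) | j < n].
Proof.
rewrite /word_dot big_lift_perm; apply: eq_bigr => k _.
rewrite mulr_sumr; apply: eq_bigr => s _.
rewrite inversions_lift exprD big_ord_recl lift_perm_id tnth0 (eq_sym i) mulrACA.
congr (_ * _); congr (_ * _); apply: eq_bigr => j _.
by rewrite lift_perm_lift tnth_mktuple tnthS.
Qed.

End WordDot.

(** * Inner products of finite sums *)

Section DotSums.
Variables (R : realType) (V : preHilbertType R).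

Lemma dot_suml (I : Type) (r : seq I) (P : pred I) (f : I -> V) y :
  dot (\sum_(i <- r | P i) f i) y = \sum_(i <- r | P i) dot (f i) y.
Proof. exact: (big_morph (dot^~ y) (fun a b => dotDl a b y) (dot0l y)). Qed.

Lemma dot_sumr (I : Type) (r : seq I) (P : pred I) (f : I -> V) y :
  dot y (\sum_(i <- r | P i) f i) = \sum_(i <- r | P i) dot y (f i).
Proof. exact: (big_morph (dot y) (fun a b => dotDr a b y) (dot0r y)). Qed.

End DotSums.

(** * Basis vectors of Fock space, creation and annihilation *)

Section Kets.
Variables (R : realType) (d : nat) (q : R) (hq : -1 < q < 1).
Local Notation fock := (q_fock d hq).
Implicit Types u v w : seq 'I_d.

Definition tket n (u : n.-tuple 'I_d) : q_tensor d hq n := [ffun v => (v == u)%:R].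

(** Indexed by lists rather than tuples, so that the length of the word can vary without casts. *)
Definition ket u : fock := homogeneous (tket (in_tuple u)).

Lemma ket_tuple n (u : n.-tuple 'I_d) : ket u = homogeneous (tket u).
Proof.
case: u => u un; rewrite /ket /=; move/eqP: (un) => e; case: _ / e in un *.
by congr (homogeneous (tket _)); apply: val_inj.
Qed.

Lemma ket_nil : ket [::] = vacuum d hq.
Proof.
congr homogeneous; apply/ffunP => v; rewrite !ffunE.
by rewrite [v]tuple0 [in_tuple _]tuple0 eqxx.
Qed.

Lemma pure_tensor_ket n (u : n.-tuple 'I_d) :
  pure_tensor hq [tuple basis_vector R (tnth u j) | j < n] = ket u.
Proof.
rewrite ket_tuple; congr homogeneous; apply/ffunP => v; rewrite !ffunE.
under eq_bigr do rewrite tnth_mktuple mxE eqxx /=.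
have [->|uv] := eqVneq v u; first by rewrite big1 // => j _; rewrite eqxx.
have [j uj] : exists j, tnth v j != tnth u j.
  apply/existsP; apply: contra_neqT uv; rewrite negb_exists => /forallP uv.
  by apply: eq_from_tnth => j; apply/eqP/negPn/uv.
by rewrite (bigD1 j) //= (negbTE uj) mul0r.
Qed.

Lemma creation_ket i (L : 'B(fock)) u : is_creation i L -> L (ket u) = ket (i :: u).
Proof.
case=> L0 LS; case: u => [|j u].
  rewrite ket_nil L0 -(pure_tensor_ket [tuple i]); congr pure_tensor.
  by apply: eq_from_tnth => k; rewrite tnth_mktuple !ord1 !tnth0.
rewrite -(pure_tensor_ket (in_tuple (j :: u))) LS // -(pure_tensor_ket (in_tuple (i :: j :: u))).
congr pure_tensor; apply: eq_from_tnth => k; rewrite tnth_mktuple.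
case: (unliftP ord0 k) => [k'|] ->; last by rewrite !tnth0.
rewrite (tnthS _ [tuple of _]) tnth_mktuple; congr basis_vector.
by rewrite !(tnth_nth i).
Qed.

Lemma dot_tket n (u v : n.-tuple 'I_d) : dot (tket u) (tket v) = (word_dot q u v)%:C.
Proof.
rewrite [LHS]/(q_dot q _ _) /q_dot (bigD1 u) //= (bigD1 v) //= !ffunE !eqxx.
rewrite rmorph_nat !mul1r big1 ?addr0 => [|b /negbTE bv]; last first.
  by rewrite !ffunE bv rmorph_nat mulr0 mul0r.
rewrite big1 ?addr0 // => a /negbTE au; rewrite big1 // => b _.
by rewrite !ffunE au !mul0r.
Qed.

(** This is the first-letter expansion when the lengths fit; otherwise the degrees differ and both
    sides vanish. *)
Lemma dot_ket_cons i v u :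
  dot (ket (i :: v)) (ket u) =
  \sum_(k < size u) (q ^+ k * (nth i u k == i)%:R)%:C * dot (ket v) (ket (del k u)).
Proof.
have [e|ne] := eqVneq (size u) (size v).+1; last first.
  rewrite dot_hinj_neq /=; last by move/eqP; rewrite eq_sym (negbTE ne).
  rewrite big1 // => k _; rewrite dot_hinj_neq ?mulr0 // size_del //.
  by move=> e; case/eqP: ne; rewrite e prednK // (leq_ltn_trans _ (ltn_ord k)).
have [ut ->] : exists ut : (size v).+1.-tuple 'I_d, u = ut.
  by exists (Tuple (introT eqP e)).
rewrite -(big_mkord xpredT (fun k => (q ^+ k * (nth i ut k == i)%:R)%:C *
  dot (ket v) (ket (del k ut)))) size_tuple big_mkord.
rewrite (ket_tuple [tuple of i :: in_tuple v]) ket_tuple dot_hinj dot_tket word_dot_cons.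
rewrite rmorph_sum; apply: eq_bigr => k _ /=; rewrite rmorphM /= (tnth_nth i).
congr (_ * _); rewrite -dot_tket -dot_hinj; congr (dot _ _).
rewrite -[LHS](ket_tuple [tuple tnth ut (lift k j) | j < size v]); congr ket.
apply: (@eq_from_nth _ i).
  by rewrite size_del size_tuple // size_tuple.
move=> j; rewrite size_tuple => jv; rewrite (nth_map (Ordinal jv)) ?size_enum_ord //.
rewrite (tnth_nth i) /= nth_enum_ord // /del nth_cat size_take size_tuple ltn_ord.
rewrite /bump; have [kj|jk] := leqP k j; last by rewrite nth_take.
by rewrite nth_drop addSn subnKC.
Qed.

Lemma dot_homogeneousl n (x : q_tensor d hq n) (y : fock) :
  dot (homogeneous x) y = dot x (hcomp y n).
Proof.
rewrite [LHS]/(csum _) /csum !(@lim_series_single _ _ n) /= ?hinj_fun_eq.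
- by case: (dot x _).
- by move=> k kn; rewrite hinj_fun_neq ?dot0l// => e; apply: kn.
- by move=> k kn; rewrite hinj_fun_neq ?dot0l// => e; apply: kn.
Qed.

(** In each degree the component of [y] is a finite combination of the [tket v], so it is orthogonal
    to itself. *)
Lemma ket_total (y : fock) : (forall v, dot (ket v) y = 0) -> y = 0.
Proof.
move=> H; apply: hsum_eq => n; change (hcomp y n = 0).
set z := hcomp y n; have zE : z = \sum_v z v *: tket v.
  apply/ffunP => v; rewrite sum_ffunE (bigD1 v) //= !ffunE eqxx /GRing.scale /= mulr1.
  by rewrite big1 ?addr0 // => w /negbTE wv; rewrite !ffunE eq_sym wv /GRing.scale /= mulr0.
apply: contraTeq isT => /dot_gt0; rewrite {1}zE dot_suml big1 ?ltxx // => v _.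
by rewrite dotZl -dot_homogeneousl -ket_tuple H mulr0.
Qed.

(** Both sides have the same inner product with every [ket v], by adjointness and [dot_ket_cons]. *)
Lemma annihilation_ket i (L Ls : 'B(fock)) u : is_creation i L -> is_adjoint L Ls ->
  Ls (ket u) =
  \sum_(k < size u) (q ^+ k * (nth i u k == i)%:R)%:C *: ket (del k u).
Proof.
move=> hL hLs; apply/eqP; rewrite -subr_eq0; apply/eqP/ket_total => v.
rewrite dotDr -scaleN1r dotZr rmorphN1 mulN1r -hLs (creation_ket _ hL) dot_ket_cons.
by rewrite dot_sumr; apply/eqP; rewrite subr_eq0; apply/eqP/eq_bigr => k _;
  rewrite dotZr; congr (_ * _); apply/esym/conjc_real.
Qed.

End Kets.

(** * Bounded operators: linearity, adjoints and words *)

Section Operators.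
Variables (R : realType) (V : preHilbertType R).
Implicit Types (x y z : V) (T A : 'B(V)).

Lemma bopME T A x : (T * A) x = T (A x).
Proof. by []. Qed.

Lemma bop_sumE (I : Type) (r : seq I) (F : I -> 'B(V)) x :
  (\sum_(i <- r) F i) x = \sum_(i <- r) F i x.
Proof. exact: (big_morph (fun T : 'B(V) => T x)). Qed.

Lemma bopZ T (a : R[i]) x : T (a *: x) = a *: T x.
Proof.
have T0 : T 0 = 0 by apply: (addrI (T 0)); rewrite -bopD !addr0.
by have := (bopP T).1 a x 0; rewrite T0 !addr0.
Qed.

Lemma bop_sumr (I : Type) (r : seq I) T (f : I -> V) :
  T (\sum_(i <- r) f i) = \sum_(i <- r) T (f i).
Proof. by apply: (big_morph T (bopD T)); rewrite -(scale0r 0) bopZ !scale0r. Qed.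

Lemma adjointC (A B : 'B(V)) : is_adjoint A B -> is_adjoint B A.
Proof. by move=> AB x y; rewrite [LHS]dotJ -AB -dotJ. Qed.

Lemma selfadjointD_adjoint (A B : 'B(V)) : is_adjoint A B -> is_selfadjoint (A + B).
Proof.
move=> AB x y; rewrite [(A + B) x]/(A x + B x) [(A + B) y]/(A y + B y).
by rewrite dotDl dotDr AB (adjointC AB) addrC.
Qed.

(** A Cauchy-Schwarz inequality up to the factor 2, enough for continuity: [Re_dot_le] is applied
    after rescaling [x] to the norm of [y]. *)
Lemma Re_dot_bound x y : `|complex.Re (dot x y)| <= hnorm x * hnorm y *+ 2.
Proof.
have [->|x0] := eqVneq x 0; first by rewrite dot0l normr0 hnorm0 mul0r mul0rn.
have [->|y0] := eqVneq y 0; first by rewrite dot0r normr0 hnorm0 mulr0 mul0rn.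
have a0 : 0 < hnorm x by rewrite sqrtr_gt0 hnorm2_gt0.
have b0 : 0 < hnorm y by rewrite sqrtr_gt0 hnorm2_gt0.
have := Re_dot_le ((hnorm y / hnorm x)%:C *: x) y.
have ReZ (c : R) (z : R[i]) : complex.Re (c%:C * z) = c * complex.Re z.
  by case: z => e f /=; rewrite mul0r subr0.
rewrite dotZl ReZ hnorm2Z -!sqr_hnorm normrM /=.
rewrite [`|_ / _|]gtr0_norm ?divr_gt0 // expr0n addr0 -exprMn divfK ?gt_eqF //.
rewrite mulrAC ler_pdivrMr // => H.
rewrite -(ler_pM2l b0); apply: le_trans H _.
by rewrite le_eqVlt; apply/orP; left; apply/eqP; ring.
Qed.

(** The first letter acts first, in the order in which [wick] reads the word. *)
Fixpoint word_op (I : Type) (A : I -> 'B(V)) (w : seq I) : 'B(V) :=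
  if w is i :: w' then word_op A w' * A i else 1.

End Operators.

(** * Vacuum moments of words in [L i + Ls i] *)

Section FockMoments.
Variables (R : realType) (d : nat) (q : R) (hq : -1 < q < 1).
Variables L Ls : 'I_d -> 'B(q_fock d hq).
Hypothesis hL : forall i, is_creation i (L i).
Hypothesis hLs : forall i, is_adjoint (L i) (Ls i).

Lemma dot_ket_vacuum u : dot (ket hq u) (vacuum d hq) = (u == [::])%:R.
Proof.
rewrite -ket_nil; case: u => [|j u]; last by rewrite dot_hinj_neq.
rewrite dot_hinj dot_tket word_dotE (big_pred1 1%g) => [|s]; last first.
  by apply/esym/eqP/permP => -[].
rewrite inversions_sum big_ord0 mul1r tuple_act1 eqxx.
by rewrite rmorph_nat.
Qed.

(** In the recursion of [wick], the first term comes from [L i] acting on the basis vector, and the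
    sum from [Ls i]. *)
Lemma dot_word_op w u :
  dot (word_op (fun i => L i + Ls i) w (ket hq u)) (vacuum d hq) = wick q%:C w u.
Proof.
elim: w u => [|i w IHw] u; first exact: dot_ket_vacuum.
rewrite [word_op _ (i :: w)]/(word_op _ w * (L i + Ls i)) bopME.
rewrite [(L i + Ls i) _]/(L i (ket hq u) + Ls i (ket hq u)) bopD dotDl.
rewrite (creation_ket _ (hL i)) IHw; congr (_ + _).
rewrite (annihilation_ket _ (hL i) (hLs i)) bop_sumr dot_suml.
apply: eq_bigr => k _; rewrite bopZ dotZl IHw rmorphM /= rmorphXn rmorph_nat.
by [].
Qed.

End FockMoments.

Lemma big_tuple_cons (A : nmodType) (I : finType) n (F : n.+1.-tuple I -> A) :
  \sum_w F w = \sum_i \sum_(w : n.-tuple I) F [tuple of i :: w].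
Proof.
rewrite pair_big /= (reindex (fun p : I * n.-tuple I => [tuple of p.1 :: p.2])) //=.
exists (fun w => (thead w, [tuple of behead w])) => [[i w] _|w _] /=.
  by rewrite theadE; congr (_, _); apply: val_inj.
by rewrite [RHS]tuple_eta.
Qed.

(** * Operators on the Hilbert tensor product *)

Section TensorOperators.
Variables (R : realType) (H1 H2 K : hilbertType R) (tens : H1 -> H2 -> K).
Hypothesis htens : is_hilbert_tensor tens.

(** A density argument. A bound on the real part is enough, since the imaginary part of [F z] is
    minus the real part of [F ('i *: z)]. *)
Lemma tensor_total (F : K -> R[i]) (C : R) :
  (forall a x y, F (a *: x + y) = a * F x + F y) ->
  (forall z, `|complex.Re (F z)| <= C * hnorm z) ->
  (forall x y, F (tens x y) = 0) -> forall z, F z = 0.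
Proof.
move=> Flin Fbnd F0.
have F_0 : F 0 = 0.
  by have := Flin 1 0 0; rewrite scaler0 addr0 mul1r => /esym/eqP; rewrite -subr_eq0 addrK => /eqP.
have FD x y : F (x + y) = F x + F y by have := Flin 1 x y; rewrite scale1r mul1r.
have FZ a x : F (a *: x) = a * F x by have := Flin a x 0; rewrite F_0 !addr0.
have Re0 z : complex.Re (F z) = 0.
  apply: contraTeq isT => r0; have {}r0 : 0 < `|complex.Re (F z)| by rewrite normr_gt0.
  (* The error allowed below is the absolute value of the real part of [F z] divided by this
     constant, so that the bound on [F] contradicts the approximation; adding 1 keeps the divisor
     positive. *)
  have C1 : 0 < `|C| + 1 by rewrite ltr_wpDl.
  have [m [x [y zxy]]] := tens_dense htens z (divr_gt0 r0 C1).
  have Fs : F (- \sum_(j < m) tens (x j) (y j)) = 0.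
    rewrite -scaleN1r FZ (big_morph F FD F_0) big1 ?mulr0 //.
  have := Fbnd (z - \sum_(j < m) tens (x j) (y j)); rewrite FD Fs addr0.
  move: zxy; rewrite ltr_pdivlMr // => zxy le.
  have h0 := hnorm_ge0 (z - \sum_(j < m) tens (x j) (y j)).
  have CC := ler_wpM2r h0 (ler_norm C).
  have := lt_le_trans zxy (le_trans le CC).
  by rewrite mulrDr mulr1 [_ * `|C|]mulrC gtrDl ltNge h0.
move=> z; have := Re0 z; have := Re0 ('i%C *: z); rewrite FZ.
case: (F z) => a b /=; rewrite mul0r mul1r sub0r => /eqP; rewrite oppr_eq0 => /eqP -> ->.
by [].
Qed.

(** On simple tensors this follows from [tens_dot]. Density extends it to one argument, then, after
    exchanging the arguments by conjugation, to the other. *)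
Lemma tensor_selfadjoint (A : 'B(H1)) (B : 'B(H2)) (Y : 'B(K)) :
  is_selfadjoint A -> is_selfadjoint B -> is_tensor_operator tens A B Y ->
  is_selfadjoint Y.
Proof.
move=> hA hB hY.
have ext z' : (forall x y, dot (Y (tens x y)) z' = dot (tens x y) (Y z')) ->
    forall z, dot (Y z) z' = dot z (Y z').
  move=> H z; apply/eqP; rewrite -subr_eq0; apply/eqP; move: z.
  have [M M0 HM] := bop_bound Y.
  (* The constant comes from [Re_dot_bound] applied to [dot (Y z) z'] and to [dot z (Y z')]. *)
  apply: (@tensor_total _ ((M * hnorm z' + hnorm (Y z')) *+ 2)).
  - by move=> a x y; rewrite (bopP Y).1 !dotDl !dotZl; ring.
  - move=> z; rewrite raddfB; apply: le_trans (ler_normB _ _) _.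
    apply: le_trans (lerD (Re_dot_bound _ _) (Re_dot_bound _ _)) _.
    have := ler_wpM2r (hnorm_ge0 z') (HM z).
    by rewrite -subr_ge0 => H'; rewrite -subr_ge0; move: H'; set p := hnorm _;
      set r := hnorm _; set s := hnorm _; set t := hnorm _; nra.
  - by move=> x y; rewrite H subrr.
have simple x' y' z : dot (Y z) (tens x' y') = dot z (Y (tens x' y')).
  by apply: ext => x y; rewrite !hY !(tens_dot htens) hA hB.
by move=> z z'; apply: ext => x y; rewrite [LHS]dotJ -simple -dotJ.
Qed.

(** The noncommutative expansion of a power; the rightmost factor is peeled off, since it acts
    first, as in [word_op]. *)
Lemma tens_sum_pow (d m : nat) (A : 'I_d -> 'B(H1)) (B : 'I_d -> 'B(H2)) (Y : 'I_d -> 'B(K)) x y :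
  (forall i, is_tensor_operator tens (A i) (B i) (Y i)) ->
  ((\sum_i Y i) ^+ m) (tens x y) =
  \sum_(w : m.-tuple 'I_d) tens (word_op A w x) (word_op B w y).
Proof.
move=> hY; elim: m x y => [|m IHm] x y.
  by rewrite (big_pred1 [tuple]) // => w; apply/esym/eqP/tuple0.
rewrite exprSr bopME bop_sumE bop_sumr big_tuple_cons; apply: eq_bigr => i _.
by rewrite hY IHm.
Qed.

End TensorOperators.

(** * Selfadjointness and moments of [X] *)

Theorem proposition1p8 (R : realType) (d : nat) (q : R) (hd : (0 < d)%N)
  (hq : -1 < q < 1)
  (L Ls : 'I_d -> 'B(q_fock d hq))
  (hL : forall i, is_creation i (L i))
  (hLs : forall i, is_adjoint (L i) (Ls i))
  (K : hilbertType R) (tens : q_fock d hq -> q_fock d hq -> K)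
  (htens : is_hilbert_tensor tens)
  (Y : 'I_d -> 'B(K))
  (hY : forall i, is_tensor_operator tens (L i + Ls i) (L i + Ls i) (Y i)) :
  let X := (\sum_(i < d) Y i) ^+ 2 in
  is_selfadjoint X /\
  forall n : nat, (0 < n)%N ->
    vector_state (tens (vacuum d hq) (vacuum d hq)) (X ^+ n) =
    meander_poly n d%:R q%:C.
Proof.
move=> X; set S := \sum_(i < d) Y i in X *.
have Ssa : is_selfadjoint S.
  move=> x y; rewrite !bop_sumE dot_suml dot_sumr; apply: eq_bigr => i _.
  by apply: (tensor_selfadjoint htens _ _ (hY i)); apply/selfadjointD_adjoint/hLs.
split; first by move=> x y; rewrite /X expr2 !bopME !Ssa.
move=> n n0; rewrite /X -exprM /vector_state (tens_sum_pow _ _ _ hY) dot_suml.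
rewrite -(sum_wick_sqr _ n0 hd); apply: eq_bigr => w _.
(* Both tensor factors give the same vacuum moment, hence the square in [sum_wick_sqr]. *)
by have := dot_word_op hL hLs w [::]; rewrite ket_nil (tens_dot htens) => ->.
Qed.
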